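(* (Unified first law.) In the warped-product Lovelock setting of the context, suppose that the field equations $\mathcal G_{\mu\nu}=T_{\mu\nu}$ hold. Put $P=-\frac12T^a{}_a$, $\hat T_{ab}=T_{ab}+Pg_{ab}$ (so $g^{ab}\hat T_{ab}=0$), $\psi^a=\hat T^a{}_bD^br$, $A=V_n^\kappa r^n$ and $V=\frac{V_n^\kappa}{n+1}r^{n+1}$. Then the quasilocal mass $M$ satisfies $$dM=A\,\psi_a\,dy^a+P\,dV\qquad\text{on }M^2 .$$
   Context: Let $n\ge 4$, $D=n+2$, $k=\lfloor (D-1)/2\rfloor=\lfloor (n+1)/2\rfloor$, and let $a_1=1,a_2,\dots,a_k$ and $\Lambda$ be real constants. Let $(M^2,g_{ab})$ be a smooth, time-oriented two-dimensional Lorentzian manifold with Levi-Civita derivative $D_a$, and let $r>0$ be a smooth function on $M^2$. Let $(\mathcal K^n,\gamma_{ij})$ be a compact $n$-dimensional Riemannian Einstein manifold with $R_{ij}[\gamma]=(n-1)\kappa\gamma_{ij}$, $\kappa\in\{-1,0,1\}$, and volume $V_n^\kappa$. The spacetime is $M^2\times\mathcal K^n$ with metric $ds^2=g_{ab}(y)dy^ady^b+r^2(y)\gamma_{ij}(x)dx^idx^j$. Write $(Dr)^2=g^{ab}D_arD_br$. Indices $a,b$ refer to $M^2$. The symbol $\delta^{\mu_1\cdots\mu_s}_{\nu_1\cdots\nu_s}=\det(\delta^{\mu_i}_{\nu_j})$ is the generalized Kronecker delta (no factorial normalization). Let $C_{ij}{}^{kl}=R_{ij}{}^{kl}[\gamma]-\kappa\,\delta^{kl}_{ij}$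 be the Weyl tensor of $\gamma$. Put $W(0)=1$, $W(0)^i{}_j=\delta^i_j$ and, for $s\ge1$, $$W(s)=\delta^{i_1\cdots i_{2s}}_{j_1\cdots j_{2s}}C_{i_1i_2}{}^{j_1j_2}\cdots C_{i_{2s-1}i_{2s}}{}^{j_{2s-1}j_{2s}},\qquad W(s)^i{}_j=\delta^{i\,i_1\cdots i_{2s}}_{j\,j_1\cdots j_{2s}}C_{i_1i_2}{}^{j_1j_2}\cdots C_{i_{2s-1}i_{2s}}{}^{j_{2s-1}j_{2s}}.$$ Standing assumption: for all $m$, $W(m)^i{}_j=\frac{n-2m}{n}\delta^i_jW(m)$ and $W(m)$ is constant on $\mathcal K^n$. The Lovelock tensor is $$\mathcal G^\mu{}_\nu=-\sum_{m=1}^k\frac{1}{2^{m+1}}\frac{a_m}{m}\delta^{\mu\rho_1\cdots\rho_{2m}}_{\nu\sigma_1\cdots\sigma_{2m}}R_{\rho_1\rho_2}{}^{\sigma_1\sigma_2}\cdots R_{\rho_{2m-1}\rho_{2m}}{}^{\sigma_{2m-1}\sigma_{2m}}+\Lambda\delta^\mu_\nu ,$$ and the field equations are $\mathcal G_{\mu\nu}=T_{\mu\nu}$, where $T_{\mu\nu}dx^\mu dx^\nu=T_{ab}(y)dy^ady^b+r^2(y)p(y)\gamma_{ij}dx^idx^j$. The quasilocal mass is the function on $M^2$ $$M=V_n^\kappa\Big[\sum_{m=1}^k\frac{a_m}{2^{m+1}m}\frac{r^{n-2m+1}}{n-2m+1}W(m)-\frac{r^{n+1}}{n+1}\Lambda+\sum_{m=1}^k\sum_{l=0}^{m-1}a_m2^{l-m}\frac{r^{n-2m+1}}{l+1}\binom{m-1}{l}\Big(\prod_{p=0}^{2l}(n-2m+2+p)\Big)(\kappa-(Dr)^2)^{l+1}W(m-1-l)\Big],$$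 where a term with $n-2m+1=0$ in the first sum is omitted (then $W(m)=0$ since $2m>n$). *)

(* Defs.v *)
From HB Require Import structures.
From mathcomp Require Import all_boot all_order all_algebra.
From mathcomp Require Import all_classical all_reals all_analysis.

Set Implicit Arguments.
Unset Strict Implicit.
Unset Printing Implicit Defensive.

Import Order.TTheory GRing.Theory Num.Theory.
Import numFieldNormedType.Exports.

Local Open Scope classical_set_scope.
Local Open Scope ring_scope.

(** * Calculus on R^d *)

Definition partial (R : realType) (d : nat) (V : normedModType R)
    (a : 'I_d) (f : 'rV[R]_d -> V) (x : 'rV[R]_d) : V :=
  'D_(delta_mx 0 a) f x.

(* C^oo on an open set U: every iterated partial derivative exists and is
   differentiable at every point of U. *)
Definition smooth_on (R : realType) (d : nat) (V : normedModType R)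
    (U : set 'rV[R]_d) (f : 'rV[R]_d -> V) : Prop :=
  forall (s : seq 'I_d) (x : 'rV[R]_d), U x ->
    differentiable (foldr (@partial R d V) f s) x.

Definition grad (R : realType) (d : nat) (f : 'rV[R]_d -> R) (x : 'rV[R]_d) :
    'rV[R]_d :=
  \row_a partial a f x.

(* Lebesgue integral over R^n of a nonnegative Borel function, as an iterated
   integral (Tonelli). *)
Fixpoint lebesgue_int (R : realType) (n : nat) :
    ('rV[R]_n -> \bar R) -> \bar R :=
  match n return ('rV[R]_n -> \bar R) -> \bar R with
  | 0 => fun f => f 0
  | n'.+1 => fun f =>
      (\int[lebesgue_measure]_(t in [set: R])
         lebesgue_int (fun v : 'rV[R]_n' => f (row_mx (t%:M : 'M[R]_1) v)))%E
  end.

(** * Smooth manifolds *)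

(* Only the values of [chart_map i] on [chart_dom i] and of [chart_inv i] on
   [chart_img i] are meaningful. *)
Record atlas (R : realType) (d : nat) (T : topologicalType) := Atlas {
  chart_index : Type;
  chart_dom : chart_index -> set T;
  chart_map : chart_index -> T -> 'rV[R]_d;
  chart_inv : chart_index -> 'rV[R]_d -> T }.

Definition chart_img (R : realType) (d : nat) (T : topologicalType)
    (A : atlas R d T) (i : chart_index A) : set 'rV[R]_d :=
  chart_map i @` chart_dom i.

(* [chart_map i] is a homeomorphism from the open set [chart_dom i] onto the
   open set [chart_img i], with inverse [chart_inv i]. *)
Definition is_chart (R : realType) (d : nat) (T : topologicalType)
    (A : atlas R d T) (i : chart_index A) : Prop :=
  [/\ open (chart_dom i), open (chart_img i),
      forall q, chart_dom i q -> chart_inv i (chart_map i q) = q,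
      forall q, chart_dom i q -> {for q, continuous (chart_map i)} &
      forall x, chart_img i x -> {for x, continuous (chart_inv i)}].

Definition overlap (R : realType) (d : nat) (T : topologicalType)
    (A : atlas R d T) (i j : chart_index A) : set 'rV[R]_d :=
  chart_map i @` (chart_dom i `&` chart_dom j).

Definition transition (R : realType) (d : nat) (T : topologicalType)
    (A : atlas R d T) (i j : chart_index A) : 'rV[R]_d -> 'rV[R]_d :=
  chart_map j \o chart_inv i.

Definition smooth_manifold (R : realType) (d : nat) (T : topologicalType)
    (A : atlas R d T) : Prop :=
  [/\ hausdorff_space T, @second_countable T,
      forall i : chart_index A, is_chart i,
      forall q : T, exists i : chart_index A, chart_dom i q &
      forall i j : chart_index A, smooth_on (overlap i j) (transition i j)].

Definition prod_atlas (R : realType) (d e : nat) (S T : topologicalType)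
    (A : atlas R d S) (B : atlas R e T) : atlas R (d + e) (S * T)%type :=
  @Atlas R (d + e) (S * T)%type (chart_index A * chart_index B)%type
    (fun ij => chart_dom ij.1 `*` chart_dom ij.2)
    (fun ij q => row_mx (chart_map ij.1 q.1) (chart_map ij.2 q.2))
    (fun ij z => (chart_inv ij.1 (lsubmx z), chart_inv ij.2 (rsubmx z))).

(** * Fields on a manifold *)

Definition smooth_fun (R : realType) (d : nat) (T : topologicalType)
    (A : atlas R d T) (f : T -> R) : Prop :=
  forall i : chart_index A, smooth_on (chart_img i) (f \o chart_inv i).

(* Tensor fields are given by their components in each chart, as functions of
   the coordinates. *)
Definition field2 (R : realType) (d : nat) (T : topologicalType)
    (A : atlas R d T) : Type :=
  chart_index A -> 'rV[R]_d -> 'M[R]_d.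

(* Symmetric covariant 2-tensor.  The library's Jacobian acts on row vectors:
   ('J f x) a b is the derivative of the b-th component of f along the a-th
   coordinate. *)
Definition sym_tensor2 (R : realType) (d : nat) (T : topologicalType)
    (A : atlas R d T) (t : field2 A) : Prop :=
  (forall (i : chart_index A) x, chart_img i x -> (t i x)^T = t i x) /\
  (forall (i j : chart_index A) x, overlap i j x ->
     t i x = jacobian (transition i j) x *m t j (transition i j x)
             *m (jacobian (transition i j) x)^T).

Definition smooth_field2 (R : realType) (d : nat) (T : topologicalType)
    (A : atlas R d T) (t : field2 A) : Prop :=
  forall (i : chart_index A) (a b : 'I_d),
    smooth_on (chart_img i) (fun x => t i x a b : R).

Definition riemannian_metric (R : realType) (d : nat) (T : topologicalType)
    (A : atlas R d T) (g : field2 A) : Prop :=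
  [/\ smooth_field2 g, sym_tensor2 g &
      forall (i : chart_index A) x, chart_img i x ->
        forall v : 'rV[R]_d, v != 0 -> 0 < (v *m g i x *m v^T) 0 0].

(* Signature (-,+,...,+). *)
Definition lorentzian_metric (R : realType) (d : nat) (T : topologicalType)
    (A : atlas R d T) (g : field2 A) : Prop :=
  [/\ smooth_field2 g, sym_tensor2 g &
      forall (i : chart_index A) x, chart_img i x ->
        exists2 E : 'M[R]_d, E \in unitmx &
          E *m g i x *m E^T =
          diag_mx (\row_a (if (a : nat) == 0%N then -1 else 1))].

(* A time orientation, represented by a continuous timelike vector field. *)
Definition time_orientation (R : realType) (d : nat) (T : topologicalType)
    (A : atlas R d T) (g : field2 A)
    (X : chart_index A -> 'rV[R]_d -> 'rV[R]_d) : Prop :=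
  [/\ forall (i : chart_index A) x, chart_img i x -> {for x, continuous (X i)},
      forall (i j : chart_index A) x, overlap i j x ->
        X j (transition i j x) = X i x *m jacobian (transition i j) x &
      forall (i : chart_index A) x, chart_img i x ->
        (X i x *m g i x *m (X i x)^T) 0 0 < 0].

Notation borel_of T := (g_sigma_algebraType (@open T)).

(* mu is the Riemannian volume measure: sqrt(det g) dx in every chart.  The
   library's generated sigma-algebras require a pointed (nonempty) type. *)
Definition riemannian_volume (R : realType) (d : nat) (T : ptopologicalType)
    (A : atlas R d T) (g : field2 A)
    (mu : {measure set (borel_of T) -> \bar R}) : Prop :=
  forall (i : chart_index A) (B : set (borel_of T)),
    measurable B -> B `<=` chart_dom i ->
    mu B = lebesgue_int (fun x : 'rV[R]_d =>
             (\1_(chart_map i @` B) x * Num.sqrt (\det (g i x)))%:E).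

(** * Curvature of a metric, in coordinates *)

(* Gamma^a_{bc} *)
Definition christoffel (R : realType) (d : nat) (g : 'rV[R]_d -> 'M[R]_d)
    (a b c : 'I_d) (x : 'rV[R]_d) : R :=
  2^-1 * \sum_e invmx (g x) a e *
    (partial b (fun y => g y e c : R) x + partial c (fun y => g y e b : R) x
     - partial e (fun y => g y b c : R) x).

(* R^a_{bcd}, with R_{abcd} = g_{ac} g_{bd} - g_{ad} g_{bc} on the unit
   sphere. *)
Definition riemann (R : realType) (d : nat) (g : 'rV[R]_d -> 'M[R]_d)
    (x : 'rV[R]_d) (a b c e : 'I_d) : R :=
  partial c (christoffel g a e b) x - partial e (christoffel g a c b) x
  + \sum_f (christoffel g a c f x * christoffel g f e b x
            - christoffel g a e f x * christoffel g f c b x).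

(* R_{ab}^{cd} *)
Definition riemann_mixed (R : realType) (d : nat) (g : 'rV[R]_d -> 'M[R]_d)
    (x : 'rV[R]_d) (a b c e : 'I_d) : R :=
  \sum_f \sum_p \sum_q
    g x a f * riemann g x f b p q * invmx (g x) p c * invmx (g x) q e.

(* R_{bd} = R^a_{bad} *)
Definition ricci (R : realType) (d : nat) (g : 'rV[R]_d -> 'M[R]_d)
    (x : 'rV[R]_d) : 'M[R]_d :=
  \matrix_(b, e) \sum_a riemann g x a b a e.

Definition einstein (R : realType) (d : nat) (T : topologicalType)
    (A : atlas R d T) (g : field2 A) (c : R) : Prop :=
  forall (i : chart_index A) x, chart_img i x -> ricci (g i) x = c *: g i x.

(** * Generalized Kronecker delta and Lovelock tensor *)

Definition gdelta (R : realType) (d s : nat) (mu nu : s.-tuple 'I_d) : R :=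
  \det (\matrix_(i < s, j < s) (tnth mu i == tnth nu j)%:R).

Lemma ltn_even_index (s : nat) (t : 'I_s) : (t.*2 < s.*2)%N.
Proof. by rewrite ltn_double. Qed.

Lemma ltn_odd_index (s : nat) (t : 'I_s) : (t.*2.+1 < s.*2)%N.
Proof. by rewrite ltn_Sdouble. Qed.

Definition even_index (s : nat) (t : 'I_s) : 'I_s.*2 :=
  Ordinal (ltn_even_index t).

Definition odd_index (s : nat) (t : 'I_s) : 'I_s.*2 :=
  Ordinal (ltn_odd_index t).

(* Q_{i1 i2}^{j1 j2} ... Q_{i(2s-1) i(2s)}^{j(2s-1) j(2s)} *)
Definition pair_prod (R : realType) (d s : nat)
    (Q : 'I_d -> 'I_d -> 'I_d -> 'I_d -> R) (rho sigma : s.*2.-tuple 'I_d) : R :=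
  \prod_(t < s)
    Q (tnth rho (even_index t)) (tnth rho (odd_index t))
      (tnth sigma (even_index t)) (tnth sigma (odd_index t)).

(* Full contraction of Q ... Q (s factors) with the generalized delta; it is 1
   for s = 0 (a single empty term). *)
Definition delta_contract (R : realType) (d s : nat)
    (Q : 'I_d -> 'I_d -> 'I_d -> 'I_d -> R) : R :=
  \sum_(rho : s.*2.-tuple 'I_d) \sum_(sigma : s.*2.-tuple 'I_d)
    gdelta R rho sigma * pair_prod Q rho sigma.

(* Same with one free index pair, upper mu and lower nu; it is delta^mu_nu for
   s = 0. *)
Definition delta_contract1 (R : realType) (d s : nat)
    (Q : 'I_d -> 'I_d -> 'I_d -> 'I_d -> R) (mu nu : 'I_d) : R :=
  \sum_(rho : s.*2.-tuple 'I_d) \sum_(sigma : s.*2.-tuple 'I_d)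
    gdelta R [tuple of mu :: rho] [tuple of nu :: sigma] * pair_prod Q rho sigma.

(* C_{ij}^{kl} = R_{ij}^{kl} - kappa delta^{kl}_{ij} *)
Definition weyl (R : realType) (d : nat) (kappa : R) (g : 'rV[R]_d -> 'M[R]_d)
    (x : 'rV[R]_d) (i j k l : 'I_d) : R :=
  riemann_mixed g x i j k l - kappa * gdelta R [tuple k; l] [tuple i; j].

(* G^mu_nu *)
Definition lovelock (R : realType) (d : nat) (a : nat -> R) (Lam : R)
    (h : 'rV[R]_d -> 'M[R]_d) (z : 'rV[R]_d) : 'M[R]_d :=
  \matrix_(mu, nu)
    (- (\sum_(1 <= m < (d.-1)./2.+1)
          (2 ^+ m.+1)^-1 * (a m / m%:R)
          * delta_contract1 m (riemann_mixed h z) mu nu)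
     + Lam * (mu == nu)%:R).

(** * Warped products *)

(* g_ab dy^a dy^b + f gamma_ij dx^i dx^j, with f a function on the first
   factor. *)
Definition warped_tensor (R : realType) (d e : nat) (S T : topologicalType)
    (A : atlas R d S) (B : atlas R e T) (t : field2 A) (f : S -> R)
    (gam : field2 B) : field2 (prod_atlas A B) :=
  fun (ij : chart_index A * chart_index B) z =>
    block_mx (t ij.1 (lsubmx z)) 0
             0 (f (chart_inv ij.1 (lsubmx z)) *: gam ij.2 (rsubmx z)).

(* G_{mu nu} = T_{mu nu}, where G_{mu nu} = h_{mu lambda} G^lambda_nu. *)
Definition lovelock_equations (R : realType) (d : nat) (T : topologicalType)
    (A : atlas R d T) (a : nat -> R) (Lam : R) (h t : field2 A) : Prop :=
  forall (i : chart_index A) z, chart_img i z ->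
    h i z *m lovelock a Lam (h i) z = t i z.

(** * Quasilocal quantities, in a chart of the two-dimensional factor *)

(* The mass as a function of V_n^kappa, the constants W(m), r and (Dr)^2.  The
   subtractions of naturals are exact since 2m <= n+1. *)
Definition mass_formula (R : realType) (n : nat) (a : nat -> R) (Lam kappa : R)
    (vol : R) (w : nat -> R) (r Dr2 : R) : R :=
  vol *
  (\sum_(1 <= m < n.+1./2.+1 | (2 * m != n.+1)%N)
     a m / (2 ^+ m.+1 * m%:R)
     * (r ^+ (n.+1 - 2 * m) / (n.+1 - 2 * m)%:R) * w m
   - r ^+ n.+1 / n.+1%:R * Lam
   + \sum_(1 <= m < n.+1./2.+1) \sum_(0 <= l < m)
       a m * (2 ^+ l / 2 ^+ m) * (r ^+ (n.+1 - 2 * m) / l.+1%:R)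
       * 'C(m.-1, l)%:R
       * (\prod_(0 <= p < (2 * l).+1) (n%:R - 2 * m%:R + 2 + p%:R))
       * (kappa - Dr2) ^+ l.+1 * w (m.-1 - l)%N).

Section Quasilocal.
Variables (R : realType) (n : nat) (T : topologicalType) (A : atlas R 2 T).
Variables (g t : field2 A) (r : T -> R) (vol : R).
Variable i : chart_index A.

Definition local_radius (y : 'rV[R]_2) : R := r (chart_inv i y).

(* (Dr)^2 = g^{ab} D_a r D_b r *)
Definition grad_sq (y : 'rV[R]_2) : R :=
  (grad local_radius y *m invmx (g i y) *m (grad local_radius y)^T) 0 0.

Definition quasilocal_mass (a : nat -> R) (Lam kappa : R) (w : nat -> R)
    (y : 'rV[R]_2) : R :=
  mass_formula n a Lam kappa vol w (local_radius y) (grad_sq y).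

(* P = - T^a_a / 2 *)
Definition work_density (y : 'rV[R]_2) : R :=
  - (2^-1 * \tr (invmx (g i y) *m t i y)).

(* \hat T_{ab} = T_{ab} + P g_{ab} *)
Definition traceless_stress (y : 'rV[R]_2) : 'M[R]_2 :=
  t i y + work_density y *: g i y.

(* psi^a = \hat T^a_b D^b r *)
Definition energy_flux (y : 'rV[R]_2) : 'cV[R]_2 :=
  (invmx (g i y) *m traceless_stress y)
  *m (invmx (g i y) *m (grad local_radius y)^T).

(* psi_a = g_{ab} psi^b *)
Definition energy_flux_low (y : 'rV[R]_2) : 'rV[R]_2 :=
  (g i y *m energy_flux y)^T.

Definition area (y : 'rV[R]_2) : R := vol * local_radius y ^+ n.

Definition areal_volume (y : 'rV[R]_2) : R :=
  vol / n.+1%:R * local_radius y ^+ n.+1.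

End Quasilocal.

(* Main.v *)
Require Import Defs.
From HB Require Import structures.
From mathcomp Require Import all_boot all_order all_fingroup all_algebra.
From mathcomp Require Import all_classical all_reals all_analysis.
From mathcomp Require Import ring zify.

(* In [G^a_b] the antisymmetrization leaves room for at most one further index
   of [M^2], so the curvature [R_{ab}^{cd}] of [M^2] never contributes, and only
   [R_{ij}^{kl} = (C + x delta)_{ij}^{kl} / r^2] with [x = kappa - (Dr)^2], and
   [R_{ai}^{bj} = - (D_a D^b r / r) delta_i^j] remain.  Hence [G^a_b] is affine in
   [D_a D^b r], with coefficients given by the polynomials
   [F_m(x) = sum_l C(m,l) (2x)^l prod_{p<2l} (n-2m+1+p) W(m-l)].  The combination
   [T_{ab} D^b r - T^c_c D_a r] that makes up the right-hand side of the first law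
   retains, besides a multiple of [D_a r], only [D_a D_b r D^b r = D_a (Dr)^2 / 2],
   and [F_m' = 2m (n-2m+1) (n-2m+2) F_{m-1}] identifies it with the derivative of
   the mass. *)

Set Implicit Arguments.
Unset Strict Implicit.
Unset Printing Implicit Defensive.

Import Order.TTheory GRing.Theory Num.Theory.
Import numFieldNormedType.Exports.

Local Open Scope classical_set_scope.
Local Open Scope ring_scope.

(** Every contraction is computed by induction on the number of curvature factors. Peeling off one
    factor puts two of its indices on each side of the delta, so the inductive statements carry
    arbitrary index lists [mu] and [nu] in front, and the delta is taken on sequences, whose length
    may vary, rather than on tuples. All numerical factors then come from one trace rule,
    [sum_sdelta_front]: summing over a repeated index multiplies the delta by the dimension minus
    the number of remaining pairs. The bound on base indices is a pigeonhole argument: a nonzero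
    delta has distinct indices on one side and a permutation of them on the other, and the free
    index already takes one of the two base values. Up to its constant term, the polynomial in the
    mass is [F_m / (n-2m+1)], which makes no sense when [2m = n+1]. Its relations to [F_m] and to
    [F_{m-1}] are therefore proved separately and without division, and [F_m] is shown to vanish in
    that case. *)

Lemma det_bordered (R : idomainType) (n : nat) (c : 'M[R]_1) (v : 'rV[R]_n)
    (u : 'cV[R]_n) (N : 'M[R]_n) :
  \det (block_mx c v u N) = c 0 0 * \det N - (v *m \adj N *m u) 0 0.
Proof.
(* The identity is multiplied by [\det P] for [P] = X + N, whose determinant is
   a nonzero polynomial, and then evaluated at X = 0. *)
pose P : 'M[{poly R}]_n := char_poly_mx (- N).
pose C (p q : nat) (B : 'M[R]_(p, q)) := map_mx polyC B.
have P0 : \det P != 0 by rewrite -/(char_poly (- N)) monic_neq0 ?char_poly_monic.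
have key : \det (block_mx (C _ _ c) (C _ _ v) (C _ _ u) P) =
    (C _ _ c) 0 0 * \det P - (C _ _ v *m \adj P *m C _ _ u) 0 0.
  apply: (mulIf P0); set B := block_mx _ _ _ _.
  (* Right multiplication by [D], of determinant [\det P], clears the lower left block of [B],
     because [P *m \adj P] is the scalar matrix [\det P]. *)
  pose D : 'M[{poly R}]_(1 + n) := block_mx (\det P)%:M 0 (- (\adj P *m C _ _ u)) 1%:M.
  have -> : \det B * \det P = \det (B *m D).
    by rewrite det_mulmx det_lblock det1 mulr1 det_scalar1.
  rewrite mulmx_block !mulmx0 !mulmx1 !add0r mulmxN mulmxA mulmxN mulmxA mul_mx_adj.
  rewrite mul_scalar_mx !mul_mx_scalar subrr det_ublock; congr (_ * _).
  by rewrite det_mx11 !mxE mulrC.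
have ev0 (p q : nat) (B : 'M[R]_(p, q)) : map_mx (horner_eval 0) (C _ _ B) = B.
  by apply/matrixP => i j; rewrite !mxE /horner_eval hornerC.
have evP : map_mx (horner_eval 0) P = N.
  apply/matrixP => i j; rewrite !mxE /horner_eval hornerD hornerN hornerMn hornerX.
  by rewrite mul0rn hornerC sub0r opprK.
have := congr1 (horner_eval (0 : R)) key.
rewrite -det_map_mx map_block_mx evP !ev0 rmorphB rmorphM -det_map_mx evP => ->.
congr (_ - _); first by rewrite mxE; congr (_ * _); exact: hornerC.
have -> : \adj N = map_mx (horner_eval 0) (\adj P) by rewrite map_mx_adj evP.
by rewrite -{2}(ev0 _ _ v) -{2}(ev0 _ _ u) -!map_mxM [in RHS]mxE.
Qed.

(** * The generalized Kronecker delta on sequences *)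

Section DeltaSeq.
Variable R : realType.

Definition delta_mat (T : eqType) (k : nat) (mu nu : seq T) : 'M[R]_k :=
  \matrix_(i < k, j < k) (onth mu i == onth nu j)%:R.

(* Meant for sequences of equal size: the determinant has the size of [mu], and
   two out-of-range entries would count as equal. *)
Definition sdelta (T : eqType) (mu nu : seq T) : R :=
  \det (delta_mat (size mu) mu nu).

Lemma gdelta_sdelta d s (mu nu : s.-tuple 'I_d) : gdelta R mu nu = sdelta mu nu.
Proof.
rewrite /gdelta /sdelta size_tuple; congr (\det _); apply/matrixP => i j.
have on (t : s.-tuple 'I_d) (k : 'I_s) : onth t k = Some (tnth t k).
  exact/tnth_onth.
by rewrite !mxE !on.
Qed.

Lemma sdeltaC (T : eqType) (mu nu : seq T) : size mu = size nu ->
  sdelta mu nu = sdelta nu mu.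
Proof.
rewrite /sdelta => <-; rewrite -det_tr; congr (\det _).
by apply/matrixP => i j; rewrite !mxE eq_sym.
Qed.

Lemma sdelta_swapl (T : eqType) (mu1 mu2 nu : seq T) x y :
  sdelta (mu1 ++ x :: y :: mu2) nu = - sdelta (mu1 ++ y :: x :: mu2) nu.
Proof.
rewrite /sdelta !size_cat /=.
set k := (size mu1 + (size mu2).+2)%N.
have h1 : (size mu1 < k)%N by rewrite /k -addSnnS leq_addr.
have h2 : ((size mu1).+1 < k)%N by rewrite /k -!addSnnS leq_addr.
pose i1 := Ordinal h1; pose i2 := Ordinal h2.
have i12 : i1 != i2 by rewrite -val_eqE /= neq_ltn ltnSn.
have -> : delta_mat k (mu1 ++ x :: y :: mu2) nu =
    xrow i1 i2 (delta_mat k (mu1 ++ y :: x :: mu2) nu).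
  apply/matrixP => i j; rewrite !mxE; congr ((_ == _)%:R).
  rewrite !onth_cat; case: tpermP => [->|->|/eqP ni1 /eqP ni2] /=.
  - by rewrite ltnn subnn ltnNge leqnSn /= subSnn.
  - by rewrite ltnn subnn ltnNge leqnSn /= subSnn.
  case: ifP => // /negbT; rewrite -leqNgt => li.
  have [m em] : exists m, (i - size mu1)%N = m.+2.
    move: ni1 ni2; rewrite -!val_eqE /= => a1 a2.
    exists (i - (size mu1).+2)%N; rewrite -subSn; last first.
      by rewrite !ltn_neqAle eq_sym a2 eq_sym a1.
    by rewrite subSS -subSn ?subSS // ltn_neqAle eq_sym a1.
  by rewrite em.
by rewrite xrowE det_mulmx det_perm odd_tperm i12 mulN1r.
Qed.

Lemma sdelta_swapr (T : eqType) (mu nu1 nu2 : seq T) x y :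
  size mu = (size nu1 + (size nu2).+2)%N ->
  sdelta mu (nu1 ++ x :: y :: nu2) = - sdelta mu (nu1 ++ y :: x :: nu2).
Proof.
move=> e; rewrite sdeltaC ?size_cat // sdelta_swapl sdeltaC ?size_cat //.
Qed.

(** Each step of [x] to the left costs a sign, and so does each step of [y]; both pass equally many
    entries, so the signs cancel. *)
Lemma sdelta_front (T : eqType) (mu1 mu2 nu1 nu2 : seq T) x y :
  size mu1 = size nu1 -> size mu2 = size nu2 ->
  sdelta (mu1 ++ x :: mu2) (nu1 ++ y :: nu2) =
  sdelta (x :: mu1 ++ mu2) (y :: nu1 ++ nu2).
Proof.
elim/last_ind: mu1 nu1 mu2 nu2 => [|mu1 a IH] nu1 mu2 nu2.
  by case: nu1.
case/lastP: nu1 => [|nu1 b]; rewrite !size_rcons // => -[e1] e2.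
rewrite !cat_rcons sdelta_swapl sdelta_swapr ?opprK ?size_cat /= ?e1 ?e2 //.
by rewrite (IH nu1 (a :: mu2) (b :: nu2)) //= e2.
Qed.

(** The new indices enter the second term only through a row and a column of Kronecker symbols, so
    that the sum over [x = y] becomes a trace. *)
Lemma sdelta_cons (T : eqType) (mu nu : seq T) x y : size mu = size nu ->
  sdelta (x :: mu) (y :: nu) = (x == y)%:R * sdelta mu nu -
    ((\row_(j < size mu) (Some x == onth nu j)%:R) *m
      \adj (delta_mat (size mu) mu nu) *m
      (\col_(i < size mu) (onth mu i == Some y)%:R)) 0 0.
Proof.
move=> e; rewrite /sdelta /=.
have := det_bordered (const_mx (x == y)%:R) (\row_(j < size mu) (Some x == onth nu j)%:R)
  (\col_(i < size mu) (onth mu i == Some y)%:R) (delta_mat (size mu) mu nu).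
set B := block_mx _ _ _ _; rewrite mxE => <-.
suff -> : B = delta_mat (1 + size mu) (x :: mu) (y :: nu) by [].
apply/matrixP => i j; rewrite [RHS]mxE /B.
case: (split_ordP i) => i' ->; case: (split_ordP j) => j' ->;
  rewrite ?block_mxEul ?block_mxEur ?block_mxEdl ?block_mxEdr !mxE ?(ord1 i') ?(ord1
    j') //.
Qed.

(** In [sdelta_cons] the first term contributes [d] times the delta. The second sums to the trace of
    [\adj N *m N], a scalar matrix, that is, to [size mu] times the delta. *)
Lemma sum_sdelta_front d (mu nu : seq 'I_d) : size mu = size nu ->
  \sum_i sdelta (i :: mu) (i :: nu) = (d%:R - (size mu)%:R) * sdelta mu nu.
Proof.
move=> e; under eq_bigr do rewrite sdelta_cons // eqxx mul1r.
rewrite sumrB sumr_const card_ord mulrBl; congr (_ - _); first by rewrite mulr_natl.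
set N := delta_mat _ _ _; set k := size mu.
pose v i : 'rV[R]_k := \row_(j < k) (Some i == onth nu j)%:R.
pose u i : 'cV[R]_k := \col_(l < k) (onth mu l == Some i)%:R.
transitivity (\tr (\adj N *m \sum_i (u i *m v i))).
  rewrite mulmx_sumr raddf_sum; apply: eq_bigr => i _ /=.
  by rewrite -/(v i) -/(u i) mulmxA mxtrace_mulC mulmxA /mxtrace big_ord1.
suff -> : \sum_i (u i *m v i) = N.
  by rewrite mul_adj_mx mxtrace_scalar /sdelta -/N mulr_natl.
apply/matrixP => l j; rewrite summxE !mxE.
have [x ex] : exists x, onth mu l = Some x.
  by have := onthTE mu l; rewrite ltn_ord; case: onth => // x; exists x.
rewrite (bigD1 x) //= big1 ?addr0 => [|i ne]; rewrite !mxE big_ord1 !mxE ex ?eqxx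
  ?mul1r //.
by rewrite (inj_eq Some_inj) eq_sym (negPf ne) mul0r.
Qed.

Lemma sum_sdelta d (mu1 mu2 nu1 nu2 : seq 'I_d) :
  size mu1 = size nu1 -> size mu2 = size nu2 ->
  \sum_i sdelta (mu1 ++ i :: mu2) (nu1 ++ i :: nu2) =
  (d%:R - (size (mu1 ++ mu2))%:R) * sdelta (mu1 ++ mu2) (nu1 ++ nu2).
Proof.
move=> e1 e2; under eq_bigr do rewrite sdelta_front //.
by rewrite sum_sdelta_front // !size_cat e1 e2.
Qed.

(** A repeated entry of [mu] gives two equal rows. Otherwise some permutation in the Leibniz
    expansion has a nonzero product, and it matches every entry of [mu] with one of [nu]. *)
Lemma sdelta_neq0 (T : eqType) (mu nu : seq T) : size mu = size nu ->
  sdelta mu nu != 0 -> uniq mu && perm_eq mu nu.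
Proof.
case: mu => [|x0 mu']; first by case: nu.
set mu := x0 :: mu' => e; apply: contraR; rewrite negb_and => H.
have on (t : seq T) k' : (k' < size t)%N -> onth t k' = Some (nth x0 t k').
  move=> h'; have := onthTE t k'; rewrite h'.
  by case E: (onth t k') => [x|] // _; rewrite (onth_nth x0 _ _ _ E).
have [um|um] := boolP (uniq mu); last first.
  have [i [j [ij jl eij]]] := uniqPn x0 um.
  have il := ltn_trans ij jl.
  apply/eqP; apply: (@determinant_alternate _ _ _ (Ordinal il) (Ordinal jl)).
    by rewrite -val_eqE /= neq_ltn ij.
  by move=> k; rewrite !mxE (on mu i) // (on mu j) // eij.
move: H; rewrite um /= => np; rewrite /sdelta /determinant big1 // => s _.
apply/eqP; rewrite mulf_eq0; apply/orP; right; apply/negPn/negP => h.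
move/negP: np; apply.
have E i : onth mu (i : 'I_(size mu)) = onth nu (s i).
  move/prodf_neq0: h => /(_ i isT); rewrite !mxE.
  by case: (onth mu i =P onth nu (s i)) => // _; rewrite eqxx.
have E1 : mu = [seq nth x0 nu (i : 'I_(size mu)) | i <- [seq s i | i <- enum 'I_(size
  mu)]].
  rewrite -map_comp; apply: (@eq_from_nth _ x0).
    by rewrite size_map size_enum_ord.
  move=> i il.
  rewrite (nth_map (Ordinal il)) ?size_enum_ord //.
  have := E (Ordinal il); rewrite !on -?e ?ltn_ord // => -[->] /=.
  by congr (nth _ _ (s _)); apply: val_inj; rewrite /= nth_enum_ord.
have E2 : nu = [seq nth x0 nu (i : 'I_(size mu)) | i <- enum 'I_(size mu)].
  by rewrite map_comp val_enum_ord e map_nth_iota0 ?take_size.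
rewrite E1 [X in perm_eq _ X]E2; apply/perm_map/uniq_perm.
- by rewrite map_inj_uniq ?enum_uniq //; apply: perm_inj.
- exact: enum_uniq.
move=> i; rewrite mem_enum; apply/mapP; exists (s^-1 i)%g; rewrite ?mem_enum //.
by rewrite permKV.
Qed.

(** A base index never equals a fibre index, so the matrix of Kronecker symbols is block
    diagonal. *)
Lemma sdelta_block p q (s s' : seq 'I_p) (mu nu : seq 'I_q) :
  size s = size s' -> size mu = size nu ->
  sdelta (map (@lshift p q) s ++ map (@rshift p q) mu)
         (map (@lshift p q) s' ++ map (@rshift p q) nu) =
  sdelta s s' * sdelta mu nu.
Proof.
move=> es em; rewrite /sdelta size_cat !size_map.
set A := delta_mat _ _ _; set B := delta_mat (size s) _ _.
suff -> : A = block_mx B 0 0 (delta_mat (size mu) mu nu) by rewrite det_ublock.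
have on (T : eqType) (t : seq T) (k : nat) : (k < size t)%N -> exists x, onth t k =
  Some x.
  by move=> h; have := onthTE t k; rewrite h; case: onth => // x; exists x.
apply/matrixP => i j; rewrite [LHS]mxE !onth_cat !size_map -es.
case: (split_ordP i) => i' ->; case: (split_ordP j) => j' ->;
  rewrite ?block_mxEul ?block_mxEur ?block_mxEdl ?block_mxEdr !mxE /=
    ?ltn_ord 1?ltnNge ?leq_addr /= 1?ltnNge ?leq_addr /= ?addKn !onth_map.
- have [x ->] := on _ s i' (ltn_ord i').
  have [y ->] := on _ s' j' (leq_trans (ltn_ord j') (eq_leq es)).
  by rewrite /= !(inj_eq Some_inj) (inj_eq (@lshift_inj _ _)).
- have [x ->] := on _ s i' (ltn_ord i').
  have [y ->] := on _ nu j' (leq_trans (ltn_ord j') (eq_leq em)).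
  by rewrite /= (inj_eq Some_inj) eq_lrshift.
- have [x ->] := on _ mu i' (ltn_ord i').
  have [y ->] := on _ s' j' (leq_trans (ltn_ord j') (eq_leq es)).
  by rewrite /= (inj_eq Some_inj) eq_rlshift.
- have [x ->] := on _ mu i' (ltn_ord i').
  have [y ->] := on _ nu j' (leq_trans (ltn_ord j') (eq_leq em)).
  by rewrite /= !(inj_eq Some_inj) (inj_eq (@rshift_inj _ _)).
Qed.

End DeltaSeq.

(** * Contractions with the generalized delta *)

Section Contraction.
Variable R : realType.

Lemma sum_tuple_cons (T : finType) n (F : n.+1.-tuple T -> R) :
  \sum_t F t = \sum_i \sum_(t : n.-tuple T) F [tuple of i :: t].
Proof.
rewrite pair_big /=.
rewrite (reindex (fun p : T * n.-tuple T => [tuple of p.1 :: p.2])) //=.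
exists (fun t => (thead t, [tuple of behead t])) => [[i t] _|t _] /=.
  by congr pair; apply: val_inj.
by rewrite [t in RHS]tuple_eta.
Qed.

Lemma pair_prod_cons d m (Q : 'I_d -> 'I_d -> 'I_d -> 'I_d -> R) i j k l
    (rho sigma : m.*2.-tuple 'I_d) :
  pair_prod (s := m.+1) Q [tuple of i :: [tuple of j :: rho]]
    [tuple of k :: [tuple of l :: sigma]] =
  Q i j k l * pair_prod Q rho sigma.
Proof.
rewrite /pair_prod big_ord_recl; congr (_ * _); apply: eq_bigr => t _.
by rewrite !(tnth_nth i).
Qed.

(** The sum in [delta_contract] with an arbitrary kernel [G] on sequences in place of the delta:
    partial contractions, where some entries of the delta are held fixed, are then instances of the
    same sum. *)
Definition contr d m (G : seq 'I_d -> seq 'I_d -> R)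
    (Q : 'I_d -> 'I_d -> 'I_d -> 'I_d -> R) : R :=
  \sum_(rho : m.*2.-tuple 'I_d) \sum_(sigma : m.*2.-tuple 'I_d)
    G rho sigma * pair_prod Q rho sigma.

Lemma delta_contractE d m (Q : 'I_d -> 'I_d -> 'I_d -> 'I_d -> R) :
  delta_contract m Q = contr m (@sdelta R _) Q.
Proof. by do 2 ![apply: eq_bigr => ? _]; rewrite gdelta_sdelta. Qed.

Lemma delta_contract1E d m (Q : 'I_d -> 'I_d -> 'I_d -> 'I_d -> R) a b :
  delta_contract1 m Q a b =
  contr m (fun rho sigma => sdelta R (a :: rho) (b :: sigma)) Q.
Proof. by do 2 ![apply: eq_bigr => ? _]; rewrite gdelta_sdelta. Qed.

Lemma eq_contr d m (G G' : seq 'I_d -> seq 'I_d -> R) Q :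
  (forall rho sigma, size rho = m.*2 -> size sigma = m.*2 ->
     G rho sigma = G' rho sigma) -> contr m G Q = contr m G' Q.
Proof.
by move=> e; do 2 ![apply: eq_bigr => ? _]; rewrite e ?size_tuple.
Qed.

Lemma contr_eq0 d m (G : seq 'I_d -> seq 'I_d -> R) Q :
  (forall rho sigma, size rho = m.*2 -> size sigma = m.*2 ->
     G rho sigma = 0) -> contr m G Q = 0.
Proof.
move=> e; rewrite /contr big1 // => rho _; rewrite big1 // => sigma _.
by rewrite e ?size_tuple ?mul0r.
Qed.

Lemma contr_sum d m (I : finType) (G : I -> seq 'I_d -> seq 'I_d -> R) Q :
  \sum_i contr m (G i) Q = contr m (fun rho sigma => \sum_i G i rho sigma) Q.
Proof.
rewrite /contr exchange_big; apply: eq_bigr => rho _.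
rewrite exchange_big; apply: eq_bigr => sigma _.
by rewrite -mulr_suml.
Qed.

Lemma contr_scale d m (G : seq 'I_d -> seq 'I_d -> R) Q c :
  contr m (fun rho sigma => c * G rho sigma) Q = c * contr m G Q.
Proof.
rewrite /contr mulr_sumr; apply: eq_bigr => rho _.
by rewrite mulr_sumr; apply: eq_bigr => sigma _; rewrite mulrA.
Qed.

Lemma contr0 d (G : seq 'I_d -> seq 'I_d -> R) Q : contr 0 G Q = G [::] [::].
Proof.
have sum0 (F : 0.-tuple 'I_d -> R) : \sum_t F t = F [tuple].
  rewrite (eq_bigr (fun=> F [tuple])) => [|t _]; last by rewrite (tuple0 t).
  by rewrite sumr_const card_tuple expn0 mulr1n.
by rewrite /contr !sum0 /pair_prod big_ord0 mulr1.
Qed.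

Lemma contrS d m (G : seq 'I_d -> seq 'I_d -> R) Q :
  contr m.+1 G Q = \sum_i \sum_j \sum_k \sum_l
    Q i j k l * contr m (fun rho sigma => G (i :: j :: rho) (k :: l :: sigma)) Q.
Proof.
rewrite /contr sum_tuple_cons; apply: eq_bigr => i _.
rewrite sum_tuple_cons; apply: eq_bigr => j _.
under eq_bigr do rewrite sum_tuple_cons.
rewrite exchange_big; apply: eq_bigr => k _.
under eq_bigr do rewrite sum_tuple_cons.
rewrite exchange_big; apply: eq_bigr => l _.
rewrite mulr_sumr; apply: eq_bigr => rho _.
rewrite mulr_sumr; apply: eq_bigr => sigma _.
by rewrite pair_prod_cons mulrCA.
Qed.

Lemma contr_scaleQ d m (G : seq 'I_d -> seq 'I_d -> R) Q c :
  contr m G (fun i j k l => c * Q i j k l) = c ^+ m * contr m G Q.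
Proof.
elim: m G => [|m IH] G; first by rewrite !contr0 mul1r.
rewrite !contrS; do 4 ![rewrite mulr_sumr; apply: eq_bigr => ? _].
by rewrite IH exprS; ring.
Qed.

Lemma eq_contrQ d m (G : seq 'I_d -> seq 'I_d -> R) Q Q' :
  (forall i j k l, Q i j k l = Q' i j k l) -> contr m G Q = contr m G Q'.
Proof.
move=> e; congr contr; do 4 ![apply: funext => ?]; exact: e.
Qed.

Lemma contr_trace d m (Q : 'I_d -> 'I_d -> 'I_d -> 'I_d -> R) mu nu :
  size mu = size nu ->
  \sum_i contr m (fun rho sigma => sdelta R (mu ++ i :: rho) (nu ++ i :: sigma)) Q =
  (d%:R - (size mu)%:R - (2 * m)%:R) *
    contr m (fun rho sigma => sdelta R (mu ++ rho) (nu ++ sigma)) Q.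
Proof.
move=> e; rewrite contr_sum -contr_scale; apply: eq_contr => rho sigma s1 s2.
by rewrite sum_sdelta ?s1 // size_cat s1 natrD -mul2n opprD addrA.
Qed.

(** The indices are placed as in [weyl], so that [weyl] is [riemann_mixed] minus [kappa] times this
    tensor. *)
Definition pair_delta d (i j k l : 'I_d) : R := gdelta R [tuple k; l] [tuple i; j].

Lemma pair_deltaE d (i j k l : 'I_d) :
  pair_delta i j k l = (k == i)%:R * (l == j)%:R - (k == j)%:R * (l == i)%:R.
Proof. rewrite /pair_delta /gdelta (expand_det_row _ 0) !big_ord_recl big_ord0.
rewrite /cofactor !det_mx11 !mxE /= !(tnth_nth i) /= /bump /= addr0.
by rewrite expr0 expr1 mul1r mulN1r mulrN. Qed.

Lemma sum_delta d (F : 'I_d -> R) i : \sum_k (k == i)%:R * F k = F i.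
Proof.
rewrite (bigD1 i) //= eqxx mul1r big1 ?addr0 // => k /negPf ->.
by rewrite mul0r.
Qed.

Lemma sum_rshift p q (F : 'I_(p + q) -> R) : (forall a, F (lshift q a) = 0) ->
  \sum_i F i = \sum_i F (rshift p i).
Proof. by move=> F0; rewrite big_split_ord /= big1 ?add0r. Qed.

Lemma sum_lshift p q (F : 'I_(p + q) -> R) : (forall i, F (rshift p i) = 0) ->
  \sum_i F i = \sum_a F (lshift q a).
Proof. by move=> F0; rewrite big_split_ord /= [X in _ + X]big1 ?addr0. Qed.

Lemma sum_pair_delta d (F : 'I_d -> 'I_d -> R) i j :
  \sum_k \sum_l pair_delta i j k l * F k l = F i j - F j i.
Proof.
transitivity (\sum_k ((k == i)%:R * F k j - (k == j)%:R * F k i)).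
  apply: eq_bigr => k _.
  transitivity (\sum_l ((l == j)%:R * ((k == i)%:R * F k l) -
                        (l == i)%:R * ((k == j)%:R * F k l))).
    by apply: eq_bigr => l _; rewrite pair_deltaE; ring.
  by rewrite sumrB !sum_delta.
by rewrite sumrB !sum_delta.
Qed.

(** The two terms of [pair_delta] contribute equally by antisymmetry, whence the 2. The trace over
    [j], taken with [i] already in the list, gives the factor lowered by 1, and the trace over [i]
    gives the other one. *)
Lemma contr_pair_delta d m (Q : 'I_d -> 'I_d -> 'I_d -> 'I_d -> R) mu nu :
  size mu = size nu ->
  \sum_i \sum_j \sum_k \sum_l pair_delta i j k l *
    contr m (fun rho sigma =>
      sdelta R (mu ++ i :: j :: rho) (nu ++ k :: l :: sigma)) Q =
  2 * (d%:R - (size mu)%:R - (2 * m)%:R) * (d%:R - (size mu)%:R - (2 * m)%:R - 1) *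
    contr m (fun rho sigma => sdelta R (mu ++ rho) (nu ++ sigma)) Q.
Proof.
move=> e; set c := d%:R - _ - _; set X := contr _ _ _.
transitivity (\sum_i \sum_j 2 * contr m (fun rho sigma =>
      sdelta R (mu ++ i :: j :: rho) (nu ++ i :: j :: sigma)) Q).
  apply: eq_bigr => i _; apply: eq_bigr => j _; rewrite sum_pair_delta.
  rewrite mulrDl !mul1r; congr (_ + _); rewrite -mulN1r -contr_scale.
  apply: eq_contr => rho sigma s1 s2.
  by rewrite sdelta_swapr ?mulN1r ?opprK // size_cat /= s1 s2 e.
under eq_bigr => i _.
  rewrite -mulr_sumr.
  have := @contr_trace d m Q (rcons mu i) (rcons nu i).
  rewrite !size_rcons e => /(_ erefl).
  under eq_bigr do under eq_contr do rewrite !cat_rcons.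
  under [X in _ = _ * X]eq_contr do rewrite !cat_rcons.
  move=> ->.
  over.
rewrite /= -!mulr_sumr contr_trace // -/X -/c -e -addn1 natrD.
by rewrite /c; ring.
Qed.

Lemma sum4_comm d m (a : 'I_m -> R) (A : 'I_d -> 'I_d -> 'I_d -> 'I_d -> R)
    (K : 'I_m -> 'I_d -> 'I_d -> 'I_d -> 'I_d -> R) :
  \sum_i \sum_j \sum_k \sum_q A i j k q * (\sum_l a l * K l i j k q) =
  \sum_l a l * (\sum_i \sum_j \sum_k \sum_q A i j k q * K l i j k q).
Proof.
do 4 ![under [RHS]eq_bigr do rewrite mulr_sumr;
       rewrite [RHS]exchange_big; apply: eq_bigr => ? _ /=].
by rewrite mulr_sumr; apply: eq_bigr => ? _; rewrite mulrCA.
Qed.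

Lemma sum4_lin d (a b : R) (Q A B : 'I_d -> 'I_d -> 'I_d -> 'I_d -> R) :
  \sum_i \sum_j \sum_k \sum_l Q i j k l * (a * A i j k l + b * B i j k l) =
  a * (\sum_i \sum_j \sum_k \sum_l Q i j k l * A i j k l)
  + b * (\sum_i \sum_j \sum_k \sum_l Q i j k l * B i j k l).
Proof.
do 4 ![rewrite !mulr_sumr -big_split; apply: eq_bigr => ? _ /=].
by ring.
Qed.

Lemma sum_pascal (B : nat -> R) m :
  \sum_(l < m.+1) 'C(m, l)%:R * (B l + B l.+1) =
  \sum_(l < m.+2) 'C(m.+1, l)%:R * B l.
Proof.
rewrite [RHS]big_ord_recl /= bin0 mul1r.
under [X in _ = _ + X]eq_bigr do rewrite /bump /= add1n binS natrD mulrDl.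
under eq_bigr do rewrite mulrDr.
rewrite !big_split /= addrA; congr (_ + _).
rewrite big_ord_recl [X in _ = _ + X]big_ord_recr /= bin0 mul1r bin_small // mul0r addr0.
by [].
Qed.

(* Each factor [pair_delta] contracts with the generalized delta to the number
   computed in [contr_pair_delta]; expanding by Pascal's rule gives [F_m(x)]. *)
Lemma contr_shift d m (C : 'I_d -> 'I_d -> 'I_d -> 'I_d -> R) x mu nu :
  size mu = size nu ->
  contr m (fun rho sigma => sdelta R (mu ++ rho) (nu ++ sigma))
    (fun i j k l => C i j k l + x * pair_delta i j k l) =
  \sum_(l < m.+1) 'C(m, l)%:R * (2 * x) ^+ l *
    (\prod_(p < 2 * l) (d%:R - (size mu)%:R - (2 * m)%:R + 1 + p%:R)) *
    contr (m - l) (fun rho sigma => sdelta R (mu ++ rho) (nu ++ sigma)) C.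
Proof.
elim: m mu nu => [|m IH] mu nu e.
  by rewrite contr0 big_ord1 /= contr0 big_ord0 !mul1r.
pose T q := contr q (fun rho sigma => sdelta R (mu ++ rho) (nu ++ sigma)) C.
pose K q i j k l := contr q (fun rho sigma =>
  sdelta R (mu ++ i :: j :: rho) (nu ++ k :: l :: sigma)) C.
pose c : R := d%:R - (size mu)%:R - (2 * m.+1)%:R + 1.
pose P l : R := \prod_(p < 2 * l) (c + p%:R).
pose B l : R := (2 * x) ^+ l * P l * T (m.+1 - l)%N.
(* [B l] is the contribution of a choice of [l] factors [x * pair_delta]. The peeled factor leaves
   this number as it is when [C] is chosen in it, and raises it by one otherwise. *)
transitivity (\sum_(l < m.+1) 'C(m, l)%:R * (B l + B l.+1)); last first.
  rewrite sum_pascal; apply: eq_bigr => l _; rewrite /B !mulrA //.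
transitivity (\sum_(l < m.+1) ('C(m, l)%:R * ((2 * x) ^+ l * P l)) *
   \sum_i \sum_j \sum_k \sum_q
     (C i j k q + x * pair_delta i j k q) * K (m - l)%N i j k q); last first.
  apply: eq_bigr => l _; rewrite -mulrA; congr (_ * _).
  have lm : (l <= m)%N by rewrite -ltnS.
  transitivity ((2 * x) ^+ l * P l * (T (m - l).+1 +
    x * (2 * (d%:R - (size mu)%:R - (2 * (m - l))%:R) *
      (d%:R - (size mu)%:R - (2 * (m - l))%:R - 1) * T (m - l)%N))).
    congr (_ * _); rewrite /T contrS -contr_pair_delta // mulr_sumr -big_split /=.
    do 3 ![apply: eq_bigr => ? _; rewrite mulr_sumr -big_split /=].
    by apply: eq_bigr => ? _; rewrite mulrDl mulrA.
  rewrite /B subSS subSn // mulrDr; congr (_ + _).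
  (* With [m - l] factors left, [contr_pair_delta] yields [(c + 2l + 1)(c + 2l)], exactly the two
     new factors of the product. *)
  have -> : P l.+1 = P l * (c + (2 * l)%:R) * (c + (2 * l).+1%:R).
    by rewrite /P mulnS !big_ord_recr.
  have -> : (2 * (m - l))%:R = 2 * m%:R - 2 * l%:R :> R by rewrite natrM natrB // mulrBr.
  rewrite /c exprS -[(2 * l).+1%:R]natr1 !natrM -[m.+1%:R]natr1.
  by move: (P l) (T (m - l)%N) => Pl Tl; ring.
rewrite contrS -sum4_comm.
apply: eq_bigr => i _; apply: eq_bigr => j _; apply: eq_bigr => k _.
apply: eq_bigr => q _; congr (_ * _).
transitivity (contr m (fun rho sigma =>
    sdelta R ((mu ++ [:: i; j]) ++ rho) ((nu ++ [:: k; q]) ++ sigma))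
    (fun i j k l => C i j k l + x * pair_delta i j k l)).
  by apply: eq_contr => rho sigma _ _; rewrite -!catA.
(* Lists longer by two and one factor fewer leave the difference of [d], the list length and twice
   the number of factors unchanged, so the product is the same. *)
rewrite IH ?size_cat ?e //; apply: eq_bigr => l _; rewrite !mulrA.
congr (_ * _ * _).
  apply: eq_bigr => p _; rewrite /c e natrD !natrM -[m.+1%:R]natr1 /=.
  by ring.
by apply: eq_contr => rho sigma _ _; rewrite -!catA.
Qed.

End Contraction.

(** * Contractions over a product with a two-dimensional factor *)

Section ProductContraction.
Variables (R : realType) (n : nat).
Variable Q : 'I_(2 + n) -> 'I_(2 + n) -> 'I_(2 + n) -> 'I_(2 + n) -> R.
Local Notation lf := (@lshift 2 n).
Local Notation rg := (@rshift 2 n).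

Let QK i j k l := Q (rg i) (rg j) (rg k) (rg l).

Let base (i : 'I_(2 + n)) := (i < 2)%N.
Let base_lf c : base (lf c). Proof. by rewrite /base /=. Qed.
Let base_rg i : base (rg i) = false. Proof. by []. Qed.

Let count_rg mu : count base (map rg mu) = 0%N.
Proof. by elim: mu. Qed.

Lemma sum2_split (G : 'I_(2 + n) -> 'I_(2 + n) -> R) :
  \sum_k \sum_l G k l =
  \sum_i \sum_j G (rg i) (rg j)
  + \sum_c \sum_i (G (lf c) (rg i) + G (rg i) (lf c))
  + \sum_c \sum_d G (lf c) (lf d).
Proof.
rewrite big_split_ord /=.
under eq_bigr do rewrite big_split_ord /=.
under [X in _ + X]eq_bigr do rewrite big_split_ord /=.
rewrite !big_split /= [X in _ + (X + _)]exchange_big /=.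
under [X in _ = _ + X + _]eq_bigr do rewrite big_split /=.
rewrite big_split /=; ring.
Qed.

(** By [sdelta_neq0] a nonzero delta has equally many base indices on both sides, all distinct, and
    only two base indices exist. *)
Let sdelta_base0 (mu nu : seq 'I_(2 + n)) : size mu = size nu ->
  (count base mu != count base nu) || (2 < count base mu)%N -> sdelta R mu nu = 0.
Proof.
move=> e H; apply/eqP; apply: contraT => /(sdelta_neq0 e) /andP[um /seq.permP pm].
move: H; rewrite pm eqxx /= -pm -size_filter ltnNge => /negP; case.
rewrite (@leq_trans (size [seq lf c | c <- enum 'I_2])) //; last by rewrite size_map
  size_enum_ord.
apply: uniq_leq_size; first exact: filter_uniq.
move=> i; rewrite mem_filter => /andP[]; case: (split_ordP i) => j -> // _ _.
by apply: map_f; rewrite mem_enum.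
Qed.

Hypothesis Qbase1 : forall i j k c, Q (rg i) (rg j) (rg k) (lf c) = 0.
Hypothesis Qbase2 : forall i j k c, Q (rg i) (rg j) (lf c) (rg k) = 0.

(* Kills the delta, and is preserved by every contraction step with a nonzero
   component of [Q]. *)
Let vanish (mu nu : seq 'I_(2 + n)) :=
  (0 < count base nu)%N &&
  ((count base nu < count base mu)%N || (2 < count base nu)%N).

(** The base count of [nu] can catch up with that of [mu] only if a step adds more base indices to
    [nu] than to [mu]. Adding two pushes the positive count above two; adding one against none is a
    component that is zero by [Qbase1] and [Qbase2]. *)
Let contr_base0 m (mu nu : seq 'I_(2 + n)) : size mu = size nu -> vanish mu nu ->
  contr m (fun rho sigma => sdelta R (mu ++ rho) (nu ++ sigma)) Q = 0.
Proof.
elim: m mu nu => [|m IH] mu nu e.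
  rewrite /vanish => H; rewrite contr0 !cats0; apply: sdelta_base0 => //; lia.
rewrite /vanish => H; rewrite contrS.
have IH' i j k l : vanish (mu ++ [:: i; j]) (nu ++ [:: k; l]) ->
    Q i j k l * contr m (fun rho sigma =>
      sdelta R (mu ++ i :: j :: rho) (nu ++ k :: l :: sigma)) Q = 0.
  move=> v; rewrite -[RHS](mulr0 (Q i j k l)) -(IH _ _ _ v) ?size_cat ?e //.
  by congr (_ * _); apply: eq_contr => rho sigma _ _; rewrite -!catA.
apply: big1 => i _; apply: big1 => j _; apply: big1 => k _; apply: big1 => l _.
case: (split_ordP i) => i' ->; case: (split_ordP j) => j' ->;
case: (split_ordP k) => k' ->; case: (split_ordP l) => l' ->;
  rewrite ?Qbase1 ?Qbase2 ?mul0r // IH' //;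
  rewrite /vanish !count_cat /= ?base_lf ?base_rg; lia.
Qed.

(** Both lists already hold two base indices, so a further one on either side leads to [vanish]; all
    remaining sums run over the fibre. *)
Let contr_rg m (mu nu : seq 'I_(2 + n)) : size mu = size nu ->
  count base mu = 2 -> count base nu = 2 ->
  contr m (fun rho sigma => sdelta R (mu ++ rho) (nu ++ sigma)) Q =
  contr m (fun rho sigma => sdelta R (mu ++ map rg rho) (nu ++ map rg sigma)) QK.
Proof.
elim: m mu nu => [|m IH] mu nu e cm cn; first by rewrite !contr0.
rewrite !contrS.
have E i j k l : contr m (fun rho sigma =>
      sdelta R (mu ++ i :: j :: rho) (nu ++ k :: l :: sigma)) Q =
    contr m (fun rho sigma =>
      sdelta R ((mu ++ [:: i; j]) ++ rho) ((nu ++ [:: k; l]) ++ sigma)) Q.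
  by apply: eq_contr => rho sigma _ _; rewrite -!catA.
have E0 i j k l : [|| base i, base j, base k | base l] ->
    Q i j k l * contr m (fun rho sigma =>
      sdelta R (mu ++ i :: j :: rho) (nu ++ k :: l :: sigma)) Q = 0.
  move=> H; rewrite E contr_base0 ?mulr0 // ?size_cat ?e //.
  rewrite /vanish !count_cat /= cm cn; move: H; lia.
rewrite sum_rshift => [|c]; last by do 3![rewrite big1 // => ? _]; rewrite E0 ?base_lf.
apply: eq_bigr => i _.
rewrite sum_rshift => [|c]; last by do 2![rewrite big1 // => ? _]; rewrite E0 ?base_lf
  ?orbT.
apply: eq_bigr => j _.
rewrite sum_rshift => [|c]; last by rewrite big1 // => ? _; rewrite E0 ?base_lf ?orbT.
apply: eq_bigr => k _.
rewrite sum_rshift => [|c]; last by rewrite E0 ?base_lf ?orbT.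
apply: eq_bigr => l _.
rewrite E IH ?size_cat ?e // ?count_cat ?cm ?cn //=.
by congr (_ * _); apply: eq_contr => rho sigma _ _; rewrite -!catA.
Qed.

Variable Y : 'I_2 -> 'I_2 -> R.
Hypothesis Qmix1 : forall c d i j, Q (lf c) (rg i) (lf d) (rg j) = Y c d * (i == j)%:R.
Hypothesis Qmix2 : forall c d i j, Q (rg i) (lf c) (rg j) (lf d) = Y c d * (i == j)%:R.
Hypothesis Qmix3 : forall c d i j, Q (lf c) (rg i) (rg j) (lf d) = - (Y c d * (i ==
  j)%:R).
Hypothesis Qmix4 : forall c d i j, Q (rg i) (lf c) (lf d) (rg j) = - (Y c d * (i ==
  j)%:R).

(** Either all factors lie in the fibre, or exactly one is mixed. In the second case [m] counts the
    position of the mixed factor and 4 the orders of its two index pairs; the double sum is its base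
    part, and the trace over its fibre indices gives [n - size mu - 2(m-1)]. *)
Lemma contr_product m a b (mu nu : seq 'I_n) : size mu = size nu ->
  contr m (fun rho sigma => sdelta R (lf a :: map rg mu ++ rho)
                                     (lf b :: map rg nu ++ sigma)) Q =
  (a == b)%:R * contr m (fun rho sigma => sdelta R (mu ++ rho) (nu ++ sigma)) QK
  + 4 * m%:R * (\sum_c \sum_d sdelta R [:: a; c] [:: b; d] * Y c d) *
    (n%:R - (size mu)%:R - 2 * (m%:R - 1)) *
    contr m.-1 (fun rho sigma => sdelta R (mu ++ rho) (nu ++ sigma)) QK.
Proof.
set y := \sum_c _.
elim: m mu nu => [|m IH] mu nu e.
  rewrite !contr0 !cats0 mulr0 !mul0r addr0.
  have := @sdelta_block R 2 n [:: a] [:: b] mu nu erefl e; rewrite /= => ->.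
  congr (_ * _); rewrite sdelta_cons //= [X in _ - X](_ : _ = 0) ?subr0.
    by rewrite /sdelta det_mx00 mulr1.
  by rewrite mxE big_ord0.
pose T i j k l := contr m (fun rho sigma =>
  sdelta R (lf a :: map rg mu ++ i :: j :: rho) (lf b :: map rg nu ++ k :: l :: sigma)) Q.
pose C q := contr q (fun rho sigma => sdelta R (mu ++ rho) (nu ++ sigma)) QK.
pose K q i j := contr q (fun rho sigma => sdelta R (mu ++ i :: rho) (nu ++ j :: sigma))
  QK.
have sz : size (map rg mu) = size (map rg nu) by rewrite !size_map.
have Tswapl i j k l : T i j k l = - T j i k l.
  rewrite /T -mulN1r -contr_scale; apply: eq_contr => rho sigma _ _.
  by rewrite mulN1r -cat_cons sdelta_swapl.
have Tswapr i j k l : T i j k l = - T i j l k.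
  rewrite /T -mulN1r -contr_scale; apply: eq_contr => rho sigma s1 s2.
  by rewrite mulN1r -[in LHS](cat_cons (lf b)) sdelta_swapr //= !size_cat /= s1 s2 sz.
have TE i j k l : T i j k l = contr m (fun rho sigma =>
    sdelta R ((lf a :: map rg mu ++ [:: i; j]) ++ rho)
             ((lf b :: map rg nu ++ [:: k; l]) ++ sigma)) Q.
  by apply: eq_contr => rho sigma _ _; rewrite /= -!catA.
have T0 i j k l : vanish (lf a :: map rg mu ++ [:: i; j]) (lf b :: map rg nu ++ [:: k;
  l]) ->
    Q i j k l * T i j k l = 0.
  by move=> v; rewrite TE contr_base0 ?mulr0 //= !size_cat sz.
(* Both lists contain two base indices here, so [contr_rg] confines the other factors to the fibre;
   moving [c] and [d] to the front then splits the delta. *)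
have T1 c d i j : T (lf c) (rg i) (lf d) (rg j) = sdelta R [:: a; c] [:: b; d] * K m i j.
  rewrite TE contr_rg /= ?size_cat ?sz ?count_cat ?count_rg /= ?base_lf ?base_rg //.
  rewrite /K -contr_scale; apply: eq_contr => rho sigma s1 s2.
  rewrite -!catA /=.
  rewrite -(cat_cons (lf a)) -(cat_cons (lf b)) sdelta_front /= ?size_map ?e ?s1 ?s2 //.
  have := @sdelta_front R _ [:: lf a] (map rg mu ++ rg i :: map rg rho) [:: lf b]
    (map rg nu ++ rg j :: map rg sigma) (lf c) (lf d) erefl.
  rewrite !size_cat /= !size_map s1 s2 e => /(_ erefl) /= <-.
  have := @sdelta_block R 2 n [:: a; c] [:: b; d] (mu ++ i :: rho) (nu ++ j :: sigma)
    erefl.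
  by rewrite !size_cat /= s1 s2 e => /(_ erefl); rewrite !map_cat.
(* The peeled factor has no base index, or one on each side. The latter occurs in four arrangements,
   which contribute equally because the signs in [Qmix3] and [Qmix4] match the antisymmetry of the
   delta. *)
transitivity (\sum_i \sum_j \sum_k \sum_l QK i j k l * T (rg i) (rg j) (rg k) (rg l)
    + \sum_c \sum_i \sum_d \sum_j
        4 * (Y c d * (i == j)%:R * (sdelta R [:: a; c] [:: b; d] * K m i j))).
  rewrite contrS sum2_split [X in _ + X]big1 ?addr0; last first.
    move=> c _; apply: big1 => d _; apply: big1 => k _; apply: big1 => l _.
    apply: T0; rewrite /vanish /= !count_cat !count_rg /= !base_lf.
    case: (split_ordP k) => k' ->; case: (split_ordP l) => l' ->;
      rewrite ?base_lf ?base_rg; lia.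
  congr (_ + _).
    apply: eq_bigr => i _; apply: eq_bigr => j _.
    rewrite sum2_split [X in _ + X]big1 ?addr0 => [|c _]; last first.
      apply: big1 => d _; apply: T0.
      by rewrite /vanish /= !count_cat !count_rg /= !base_lf ?base_rg; lia.
    rewrite [X in _ + X]big1 ?addr0 // => c _; apply: big1 => k _.
    by rewrite Qbase1 Qbase2 !mul0r addr0.
  apply: eq_bigr => c _; apply: eq_bigr => i _.
  have mixE i0 j0 : (base i0 + base j0 = 1)%N ->
      \sum_k \sum_l Q i0 j0 k l * T i0 j0 k l =
      \sum_d \sum_j (Q i0 j0 (lf d) (rg j) * T i0 j0 (lf d) (rg j) +
                      Q i0 j0 (rg j) (lf d) * T i0 j0 (rg j) (lf d)).
    move=> b1; rewrite sum2_split [X in _ + X]big1 ?addr0 => [|d _]; last first.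
      apply: big1 => k _; apply: T0.
      rewrite /vanish /= !count_cat !count_rg /= !base_lf; lia.
    rewrite [X in X + _]big1 ?add0r // => k _; apply: big1 => l _; apply: T0.
    rewrite /vanish /= !count_cat !count_rg /= !base_lf ?base_rg; lia.
  rewrite !mixE ?base_lf ?base_rg // -big_split; apply: eq_bigr => d _.
  rewrite -big_split; apply: eq_bigr => j _ /=.
  rewrite Qmix1 Qmix2 Qmix3 Qmix4 (Tswapl (rg i)) (Tswapl (rg i)).
  by rewrite (Tswapr _ _ (rg j)) T1; ring.
under [X in X + _]eq_bigr => i _.
  under eq_bigr => j _.
    under eq_bigr => k _.
      under eq_bigr => l _.
        have -> : T (rg i) (rg j) (rg k) (rg l) =
          (a == b)%:R * contr m (fun rho sigma =>
             sdelta R (mu ++ i :: j :: rho) (nu ++ k :: l :: sigma)) QK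
          + 4 * m%:R * y * (n%:R - (size mu)%:R - 2 * m%:R) *
            contr m.-1 (fun rho sigma =>
             sdelta R (mu ++ i :: j :: rho) (nu ++ k :: l :: sigma)) QK.
          have := IH (mu ++ [:: i; j]) (nu ++ [:: k; l]).
          rewrite !size_cat e => /(_ erefl) IH'.
          transitivity (contr m (fun rho sigma =>
            sdelta R (lf a :: map rg (mu ++ [:: i; j]) ++ rho)
                     (lf b :: map rg (nu ++ [:: k; l]) ++ sigma)) Q).
            by apply: eq_contr => rho sigma _ _; rewrite !map_cat -!catA.
          rewrite IH'; congr (_ * _ + _ * _ * _).
          - by apply: eq_contr => rho sigma _ _; rewrite -!catA.
          - by rewrite natrD /=; ring.
          - by apply: eq_contr => rho sigma _ _; rewrite -!catA.
        over.
      over.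
    over.
  over.
rewrite /= sum4_lin.
have -> : \sum_c \sum_i \sum_d \sum_j
    4 * (Y c d * (i == j)%:R * (sdelta R [:: a; c] [:: b; d] * K m i j)) =
    4 * y * ((n%:R - (size mu)%:R - (2 * m)%:R) * C m).
  rewrite /C -contr_trace // -/(K m) /y -mulrA mulr_suml mulr_sumr.
  apply: eq_bigr => c _; rewrite exchange_big mulr_suml mulr_sumr.
  apply: eq_bigr => d _ /=; rewrite !mulr_sumr; apply: eq_bigr => i _.
  rewrite (bigD1 i) //= eqxx big1 ?addr0 => [|j /negPf ne].
    rewrite /K mulr1.
    by ring.
  by rewrite eq_sym ne mulr0 mul0r mulr0.
have CS q : \sum_i \sum_j \sum_k \sum_l QK i j k l * contr q (fun rho sigma =>
    sdelta R (mu ++ i :: j :: rho) (nu ++ k :: l :: sigma)) QK = C q.+1.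
  by rewrite /C contrS.
rewrite !CS -[m.+1%:R]natr1 natrM -/(C m) -/(C m.+1).
(* For [m = 0] the index [m.-1.+1] is 1 rather than [m], but the coefficient of that term is
   zero. *)
have [->|m0] := posnP m.
  by clearbody C; rewrite /=; ring.
by rewrite prednK //; clearbody C; ring.
Qed.
End ProductContraction.

(** * Calculus *)

Lemma near_eq_differentiable (R : realType) (V W : normedModType R)
    (f g : V -> W) (x : V) : (\near x, f x = g x) ->
  differentiable f x -> differentiable g x.
Proof.
move=> fg df; have fgx : f x = g x := nbhs_singleton fg.
have E : g \o shift x = cst (g x) + 'd f x +o_ 0 id.
  apply/eqaddoP => eps e0; have /diff_locally/eqaddoP/(_ eps e0) H := df.
  have fg0 : \forall h \near 0, f (h + x) = g (h + x).
    by move: fg; rewrite (near_shift 0) subr0.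
  apply: filterS2 H fg0 => h; rewrite /= => + fgh.
  by rewrite /GRing.add /= /GRing.opp /= fgh fgx.
apply/diff_locallyP; rewrite (diff_unique _ E); last exact: diff_continuous.
by split => //; exact: diff_continuous.
Qed.

Section Calculus.
Variables (R : realType) (d : nat).
Implicit Types (f : 'rV[R]_d -> R) (x : 'rV[R]_d) (G : 'I_d -> R).

(** Differentiability is bundled with the values of the partial derivatives, so that the rules below
    compose and compute a gradient along the structure of the function. *)
Definition has_grad f x G : Prop :=
  differentiable f x /\ forall a, partial a f x = G a.

Lemma has_gradE f x G a : has_grad f x G -> partial a f x = G a.
Proof. by case=> _ ->. Qed.

Lemma has_grad_partial f x : differentiable f x ->
  has_grad f x (fun a => partial a f x).
Proof. by []. Qed.

Lemma has_grad_eq f x G G' : has_grad f x G -> (forall a, G a = G' a) ->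
  has_grad f x G'.
Proof. by move=> [df gf] e; split=> // a; rewrite gf. Qed.

Lemma has_grad_cst (c : R) x : has_grad (fun=> c) x (fun=> 0).
Proof.
split; first exact: differentiable_cst.
by move=> a; rewrite /partial derive_cst.
Qed.

Lemma partial_cst (c : R) x a : partial a (fun=> c) x = 0.
Proof. exact: has_gradE (has_grad_cst c x). Qed.

Lemma has_gradD f g x F G : has_grad f x F -> has_grad g x G ->
  has_grad (fun y => f y + g y) x (fun a => F a + G a).
Proof.
move=> [df gf] [dg gg]; split; first exact: differentiableD.
by move=> a; rewrite -gf -gg /partial -deriveD //; apply: diff_derivable.
Qed.

Lemma has_gradN f x F : has_grad f x F ->
  has_grad (fun y => - f y) x (fun a => - F a).
Proof.
move=> [df gf]; split; first exact: differentiableN.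
by move=> a; rewrite -gf /partial -deriveN //; apply: diff_derivable.
Qed.

Lemma has_gradM f g x F G : has_grad f x F -> has_grad g x G ->
  has_grad (fun y => f y * g y) x (fun a => f x * G a + g x * F a).
Proof.
move=> [df gf] [dg gg]; split; first exact: differentiableM.
by move=> a; rewrite -gf -gg /partial [LHS]deriveM //; apply: diff_derivable.
Qed.

Lemma has_gradZ (c : R) f x F : has_grad f x F ->
  has_grad (fun y => c * f y) x (fun a => c * F a).
Proof.
move=> hf; apply: has_grad_eq (has_gradM (has_grad_cst c x) hf) _ => a /=.
by rewrite mulr0 addr0.
Qed.

Lemma has_gradX n f x F : has_grad f x F ->
  has_grad (fun y => f y ^+ n) x (fun a => n%:R * f x ^+ n.-1 * F a).
Proof.
move=> hf; elim: n => [|n IH].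
  by apply: has_grad_eq (has_grad_cst 1 x) _ => a; rewrite !mul0r.
under eq_fun do rewrite exprS.
apply: has_grad_eq (has_gradM hf IH) _ => a /=; case: n {IH} => [|n] /=.
  by rewrite expr0; ring.
by rewrite -[n.+2%:R]natr1 exprS; ring.
Qed.

Lemma has_gradV f x F : f x != 0 -> has_grad f x F ->
  has_grad (fun y => (f y)^-1) x (fun a => - (f x) ^- 2 * F a).
Proof.
move=> f0 [df gf]; split; first exact: differentiableV.
move=> a; rewrite -gf /partial [LHS]deriveV //; exact: diff_derivable.
Qed.

Lemma has_grad_sum (I : Type) (s : seq I) (P : pred I) (f : I -> 'rV[R]_d -> R) x
    (F : I -> 'I_d -> R) : (forall i, P i -> has_grad (f i) x (F i)) ->
  has_grad (fun y => \sum_(i <- s | P i) f i y) x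
           (fun a => \sum_(i <- s | P i) F i a).
Proof.
move=> h; elim: s => [|i s IH].
  under eq_fun do rewrite big_nil.
  by apply: has_grad_eq (has_grad_cst 0 x) _ => a; rewrite big_nil.
under eq_fun do rewrite big_cons.
have [Pi|Pi] := boolP (P i); last first.
  by apply: has_grad_eq IH _ => a; rewrite big_cons (negPf Pi).
by apply: has_grad_eq (has_gradD (h i Pi) IH) _ => a; rewrite big_cons Pi.
Qed.

Lemma differentiable_bigsum (I : Type) (s : seq I) (P : pred I)
    (f : I -> 'rV[R]_d -> R) x : (forall i, P i -> differentiable (f i) x) ->
  differentiable (fun y => \sum_(i <- s | P i) f i y) x.
Proof.
move=> h; apply: (proj1 (@has_grad_sum I s P f x (fun i a => partial a (f i) x) _)).
by move=> i /h /has_grad_partial.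
Qed.

Lemma differentiable_bigprod (I : Type) (s : seq I) (P : pred I)
    (f : I -> 'rV[R]_d -> R) x : (forall i, P i -> differentiable (f i) x) ->
  differentiable (fun y => \prod_(i <- s | P i) f i y) x.
Proof.
move=> h; elim: s => [|i s IH].
  by under eq_fun do rewrite big_nil; exact: differentiable_cst.
under eq_fun do rewrite big_cons.
by have [Pi|Pi] := boolP (P i) => //; apply: differentiableM => //; exact: h.
Qed.

Lemma differentiable_det k (A : 'rV[R]_d -> 'M[R]_k) x :
  (forall i j, differentiable (fun y => A y i j) x) ->
  differentiable (fun y => \det (A y)) x.
Proof.
move=> h; rewrite /determinant; apply: differentiable_bigsum => s _.
apply: differentiableM; first exact: differentiable_cst.
by apply: differentiable_bigprod => i _; exact: h.
Qed.

Lemma eq_partial_on (U : set 'rV[R]_d) f g x a : open U -> U x ->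
  (forall y, U y -> f y = g y) -> partial a f x = partial a g x.
Proof.
move=> oU Ux fg; apply: near_eq_derive.
by apply: filterS (open_nbhs_nbhs (conj oU Ux)) => y /fg.
Qed.

(** On [U] the inverse is given by Cramer's rule, a rational function of the entries. At a singular
    matrix [invmx] returns its argument, so the formula is used only near [x]. *)
Lemma differentiable_invmx k (U : set 'rV[R]_d) (A : 'rV[R]_d -> 'M[R]_k) x i j :
  open U -> U x -> (forall y, U y -> A y \in unitmx) ->
  (forall i j, differentiable (fun y => A y i j) x) ->
  differentiable (fun y => invmx (A y) i j) x.
Proof.
move=> oU Ux uA dA.
apply: (@near_eq_differentiable _ _ _ (fun y => (\det (A y))^-1 * cofactor (A y) j i)).
  apply: filterS (open_nbhs_nbhs (conj oU Ux)) => y Uy.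
  by rewrite /invmx uA // !mxE.
apply: differentiableM.
  apply: differentiableV; first exact: differentiable_det.
  by have := uA _ Ux; rewrite unitmxE unitfE.
apply: differentiableM; first exact: differentiable_cst.
by apply: differentiable_det => p q; under eq_fun do rewrite !mxE.
Qed.

End Calculus.

(** * Partial derivatives along the factors of a product *)

Section Slices.
Variables (R : realType) (d e : nat).

Lemma partial_lshift (f : 'rV[R]_(d + e) -> R) a y x :
  partial (lshift e a) f (row_mx y x) = partial a (fun y' => f (row_mx y' x)) y.
Proof.
apply: (congr1 (fun F : R -> R => lim (F @ 0^'))); apply: funext => h /=.
have -> : delta_mx 0 (lshift e a) = row_mx (delta_mx 0 a) 0 :> 'rV[R]_(d + e).
  apply/matrixP => i j; rewrite !mxE; case: (split_ordP j) => k ->;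
    by rewrite !mxE ?eq_rlshift ?andbF // (inj_eq (@lshift_inj _ _)).
by rewrite scale_row_mx add_row_mx scaler0 add0r.
Qed.

Lemma partial_rshift (f : 'rV[R]_(d + e) -> R) a y x :
  partial (rshift d a) f (row_mx y x) = partial a (fun x' => f (row_mx y x')) x.
Proof.
apply: (congr1 (fun F : R -> R => lim (F @ 0^'))); apply: funext => h /=.
have -> : delta_mx 0 (rshift d a) = row_mx 0 (delta_mx 0 a) :> 'rV[R]_(d + e).
  apply/matrixP => i j; rewrite !mxE; case: (split_ordP j) => k ->;
    by rewrite !mxE ?eq_lrshift ?andbF // (inj_eq (@rshift_inj _ _)).
by rewrite scale_row_mx add_row_mx scaler0 add0r.
Qed.

End Slices.

(** * Curvature of a warped product *)

Lemma sum_mul_invmx (R : comUnitRingType) k (A : 'M[R]_k) i j : A \in unitmx ->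
  \sum_l A i l * invmx A l j = (i == j)%:R.
Proof. by move=> uA; have := mulmxV uA; move/matrixP/(_ i j); rewrite !mxE. Qed.

Lemma sum_invmx_mul (R : comUnitRingType) k (A : 'M[R]_k) i j : A \in unitmx ->
  \sum_l invmx A i l * A l j = (i == j)%:R.
Proof. by move=> uA; have := mulVmx uA; move/matrixP/(_ i j); rewrite !mxE. Qed.

(** The antisymmetry is visible in the definition of [riemann]. It yields the components of types
    LRRL, RLLR and RRRL from those of types LRLR, RLRL and RRLR. *)
Lemma riemann_mixedC (R : realType) k (t : 'rV[R]_k -> 'M[R]_k) v a b c f :
  riemann_mixed t v a b c f = - riemann_mixed t v a b f c.
Proof.
rewrite /riemann_mixed -sumrN; apply: eq_bigr => p _.
rewrite exchange_big -sumrN; apply: eq_bigr => q _; rewrite -sumrN.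
apply: eq_bigr => s _.
have -> : riemann t v p b s q = - riemann t v p b q s.
  rewrite /riemann opprD opprB; congr (_ + _); rewrite -sumrN.
  by apply: eq_bigr => ? _; rewrite opprB.
ring.
Qed.

Section WarpedCurvature.
Variables (R : realType) (d e : nat).
Variables (U : set 'rV[R]_d) (V : set 'rV[R]_e).
Hypotheses (openU : open U) (openV : open V).
Variables (g : 'rV[R]_d -> 'M[R]_d) (r : 'rV[R]_d -> R) (gam : 'rV[R]_e -> 'M[R]_e).
Hypothesis g_diff : forall y, U y -> forall a b, differentiable (fun y => g y a b) y.
Hypothesis g_sym : forall y, U y -> forall a b, g y a b = g y b a.
Hypothesis g_unit : forall y, U y -> g y \in unitmx.
Hypothesis gam_diff : forall x, V x -> forall i j, differentiable (fun x => gam x i j) x.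
Hypothesis gam_sym : forall x, V x -> forall i j, gam x i j = gam x j i.
Hypothesis gam_unit : forall x, V x -> gam x \in unitmx.
Hypothesis r_diff : forall y, U y -> differentiable r y.
Hypothesis r_diff2 : forall y, U y -> forall a, differentiable (partial a r) y.
Hypothesis r_neq0 : forall y, U y -> r y != 0.

(* In the names below, L and R stand for an index in the left ([lf], base) and in
   the right ([rg], fibre) block. *)
Local Notation lf := (@lshift d e).
Local Notation rg := (@rshift d e).

Definition warped (z : 'rV[R]_(d + e)) : 'M[R]_(d + e) :=
  block_mx (g (lsubmx z)) 0 0 (r (lsubmx z) ^+ 2 *: gam (rsubmx z)).

Local Notation h := warped.

Definition grad_up (a : 'I_d) (y : 'rV[R]_d) : R :=
  \sum_c invmx (g y) a c * partial c r y.

Definition hess (c a : 'I_d) (y : 'rV[R]_d) : R :=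
  partial c (partial a r) y - \sum_b christoffel g b c a y * partial b r y.

Lemma warpedLL y x a b : h (row_mx y x) (lf a) (lf b) = g y a b.
Proof. by rewrite /h row_mxKl block_mxEul. Qed.

Lemma warpedLR y x a j : h (row_mx y x) (lf a) (rg j) = 0.
Proof. by rewrite /h block_mxEur mxE. Qed.

Lemma warpedRL y x i b : h (row_mx y x) (rg i) (lf b) = 0.
Proof. by rewrite /h block_mxEdl mxE. Qed.

Lemma warpedRR y x i j : h (row_mx y x) (rg i) (rg j) = r y ^+ 2 * gam x i j.
Proof. by rewrite /h row_mxKl row_mxKr block_mxEdr mxE. Qed.

Definition warpedE := (warpedLL, warpedLR, warpedRL, warpedRR).

Lemma invmx_warped y x : U y -> V x ->
  invmx (h (row_mx y x)) =
  block_mx (invmx (g y)) 0 0 ((r y ^+ 2)^-1 *: invmx (gam x)).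
Proof.
move=> Uy Vx.
have ru : r y ^+ 2 *: gam x \in unitmx.
  by rewrite unitmxZ ?gam_unit // unitfE expf_neq0 ?r_neq0.
rewrite /h row_mxKl row_mxKr invmx_block_diag; last first.
  by rewrite unitmxE det_ublock unitrM -!unitmxE g_unit.
by rewrite invmxZ.
Qed.

Section Christoffel.
Variables (y : 'rV[R]_d) (x : 'rV[R]_e).
Hypotheses (Uy : U y) (Vx : V x).
Local Notation z := (row_mx y x).

Let partial0 k (f : 'rV[R]_k -> R) v a : (forall u, f u = 0) -> partial a f v = 0.
Proof.
move=> f0; have -> : f = fun=> 0 by exact: funext.
exact: partial_cst.
Qed.

Lemma partial_warped_LLL a b c :
  partial (lf a) (fun z => h z (lf b) (lf c)) z = partial a (fun y => g y b c) y.
Proof. by rewrite partial_lshift; under eq_fun do rewrite warpedE. Qed.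

Lemma partial_warped_RLL k b c : partial (rg k) (fun z => h z (lf b) (lf c)) z = 0.
Proof.
by rewrite partial_rshift; under eq_fun do rewrite warpedE; exact: partial_cst.
Qed.

Lemma partial_warped_LR A b k : partial A (fun z => h z (lf b) (rg k)) z = 0.
Proof. by apply: partial0 => u; rewrite /h block_mxEur mxE. Qed.

Lemma partial_warped_RL A b k : partial A (fun z => h z (rg k) (lf b)) z = 0.
Proof. by apply: partial0 => u; rewrite /h block_mxEdl mxE. Qed.

Lemma partial_warped_LRR a i j : partial (lf a) (fun z => h z (rg i) (rg j)) z =
  2 * r y * partial a r y * gam x i j.
Proof.
rewrite partial_lshift; under eq_fun do rewrite warpedE mulrC.
rewrite (has_gradE _ (has_gradZ (gam x i j) (has_gradX 2 (has_grad_partial (r_diff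
  Uy))))).
by rewrite /= expr1 mulrC.
Qed.

Lemma partial_warped_RRR k i j : partial (rg k) (fun z => h z (rg i) (rg j)) z =
  r y ^+ 2 * partial k (fun x => gam x i j) x.
Proof.
rewrite partial_rshift; under eq_fun do rewrite warpedE.
exact: has_gradE (has_gradZ _ (has_grad_partial (gam_diff Vx i j))).
Qed.

Definition partial_warpedE := (partial_warped_LLL, partial_warped_RLL, partial_warped_LR,
  partial_warped_RL, partial_warped_LRR, partial_warped_RRR).

Lemma invwLL a b : invmx (h z) (lf a) (lf b) = invmx (g y) a b.
Proof. by rewrite invmx_warped // block_mxEul. Qed.
Lemma invwLR a j : invmx (h z) (lf a) (rg j) = 0.
Proof. by rewrite invmx_warped // block_mxEur mxE. Qed.
Lemma invwRL i b : invmx (h z) (rg i) (lf b) = 0.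
Proof. by rewrite invmx_warped // block_mxEdl mxE. Qed.
Lemma invwRR i j : invmx (h z) (rg i) (rg j) = (r y ^+ 2)^-1 * invmx (gam x) i j.
Proof. by rewrite invmx_warped // block_mxEdr mxE. Qed.

Definition invwE := (invwLL, invwLR, invwRL, invwRR).

Let sumL0 (F : 'I_d -> R) G : (forall a, F a = 0) -> \sum_a F a + G = G.
Proof. by move=> F0; rewrite big1 ?add0r. Qed.

Let sumR0 (F : 'I_e -> R) G : (forall a, F a = 0) -> G + \sum_a F a = G.
Proof. by move=> F0; rewrite big1 ?addr0. Qed.

Lemma christoffelLLL a b c : christoffel h (lf a) (lf b) (lf c) z = christoffel g a b c y.
Proof.
rewrite /christoffel big_split_ord /= sumR0 => [|i]; last by rewrite invwE mul0r.
by congr (_ * _); apply: eq_bigr => i _; rewrite invwE !partial_warpedE.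
Qed.

Lemma christoffelLLR a b j : christoffel h (lf a) (lf b) (rg j) z = 0.
Proof.
rewrite /christoffel big_split_ord /= sumR0 => [|i]; last by rewrite invwE mul0r.
by rewrite big1 ?mulr0 // => i _; rewrite !partial_warpedE; ring.
Qed.

Lemma christoffelLRL a b j : christoffel h (lf a) (rg j) (lf b) z = 0.
Proof.
rewrite /christoffel big_split_ord /= sumR0 => [|i]; last by rewrite invwE mul0r.
by rewrite big1 ?mulr0 // => i _; rewrite !partial_warpedE; ring.
Qed.

Lemma christoffelLRR a i j : christoffel h (lf a) (rg i) (rg j) z =
  - (r y * grad_up a y) * gam x i j.
Proof.
rewrite /christoffel big_split_ord /= sumR0 => [|k]; last by rewrite invwE mul0r.
rewrite /grad_up mulr_sumr mulr_sumr -sumrN mulr_suml; apply: eq_bigr => c _.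
by rewrite invwE !partial_warpedE; field.
Qed.

Lemma christoffelRLL i a b : christoffel h (rg i) (lf a) (lf b) z = 0.
Proof.
rewrite /christoffel big_split_ord /= sumL0 => [|k]; last by rewrite invwE mul0r.
by rewrite big1 ?mulr0 // => k _; rewrite !partial_warpedE; ring.
Qed.

Lemma christoffelRLR i a j : christoffel h (rg i) (lf a) (rg j) z =
  partial a r y / r y * (i == j)%:R.
Proof.
rewrite /christoffel big_split_ord /= sumL0 => [|k]; last by rewrite invwE mul0r.
rewrite -(sum_invmx_mul _ _ (gam_unit Vx)) !mulr_sumr; apply: eq_bigr => k _.
rewrite invwE !partial_warpedE; field; exact: r_neq0.
Qed.

Lemma christoffelRRL i a j : christoffel h (rg i) (rg j) (lf a) z =
  partial a r y / r y * (i == j)%:R.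
Proof.
rewrite /christoffel big_split_ord /= sumL0 => [|k]; last by rewrite invwE mul0r.
rewrite -(sum_invmx_mul _ _ (gam_unit Vx)) !mulr_sumr; apply: eq_bigr => k _.
rewrite invwE !partial_warpedE; field; exact: r_neq0.
Qed.

Lemma christoffelRRR i j k : christoffel h (rg i) (rg j) (rg k) z =
  christoffel gam i j k x.
Proof.
rewrite /christoffel big_split_ord /= sumL0 => [|l]; last by rewrite invwE mul0r.
rewrite !mulr_sumr; apply: eq_bigr => l _.
rewrite invwE !partial_warpedE; field; exact: r_neq0.
Qed.

End Christoffel.
Definition christoffelE := (christoffelLLL, christoffelLLR, christoffelLRL,
  christoffelLRR, christoffelRLL, christoffelRLR, christoffelRRL, christoffelRRR).

Lemma grad_up_diff y a : U y -> differentiable (grad_up a) y.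
Proof.
move=> Uy; apply: differentiable_bigsum => c _; apply: differentiableM.
  exact: differentiable_invmx openU Uy g_unit (g_diff Uy).
exact: r_diff2.
Qed.

Lemma grad_lower y b : U y -> \sum_a g y b a * grad_up a y = partial b r y.
Proof.
move=> Uy; rewrite /grad_up.
transitivity (\sum_c (b == c)%:R * partial c r y); last first.
  by under eq_bigr do rewrite eq_sym; rewrite sum_delta.
under eq_bigr do rewrite mulr_sumr.
rewrite exchange_big; apply: eq_bigr => c _.
rewrite -(sum_mul_invmx b c (g_unit Uy)) mulr_suml.
by apply: eq_bigr => a _; rewrite mulrA.
Qed.

Section Riemann.
Variables (y : 'rV[R]_d) (x : 'rV[R]_e).
Hypotheses (Uy : U y) (Vx : V x).
Local Notation z := (row_mx y x).

Lemma riemann_warped_RRRR i j k l : riemann h z (rg i) (rg j) (rg k) (rg l) =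
  riemann gam x i j k l - (\sum_a grad_up a y * partial a r y) *
    ((i == k)%:R * gam x l j - (i == l)%:R * gam x k j).
Proof.
rewrite /riemann !partial_rshift.
rewrite [X in X - _ + _](eq_partial_on _ openV Vx (g := christoffel gam i l j)); last
  first.
  move=> x' Vx' /=.
  by rewrite christoffelE.
rewrite [X in _ - X + _](eq_partial_on _ openV Vx (g := christoffel gam i k j)); last
  first.
  move=> x' Vx' /=.
  by rewrite christoffelE.
(* Fibre values of the intermediate index complete the curvature of [gam]; base values give the
   correction in [(Dr)^2]. *)
rewrite big_split_ord /= addrCA addrC; congr (_ + _).
  by congr (_ + _); apply: eq_bigr => f _; rewrite !christoffelE.
rewrite mulr_suml -sumrN; apply: eq_bigr => a _.
rewrite !christoffelE //; field; exact: r_neq0.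
Qed.

Lemma riemann_warped_RRLR i j a k : riemann h z (rg i) (rg j) (lf a) (rg k) = 0.
Proof.
rewrite /riemann partial_lshift partial_rshift.
rewrite [X in X - _ + _](eq_partial_on _ openU Uy (g := fun=> christoffel gam i k j
  x)); last first.
  move=> y' Uy' /=.
  by rewrite christoffelE.
rewrite [X in _ - X + _](eq_partial_on _ openV Vx (g := fun=> partial a r y / r y * (i
  == j)%:R)); last first.
  move=> x' Vx' /=.
  by rewrite christoffelE.
rewrite !partial_cst subrr add0r big_split_ord /= big1 ?add0r => [|b _]; last first.
  by rewrite !christoffelE // mul0r mulr0 subrr.
transitivity (\sum_l ((l == i)%:R * (partial a r y / r y * christoffel gam l k j x)
    - (l == j)%:R * (partial a r y / r y * christoffel gam i k l x))).
  by apply: eq_bigr => l _; rewrite !christoffelE // [i == l]eq_sym; ring.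
by rewrite sumrB !sum_delta subrr.
Qed.

Lemma riemann_warped_LRLR a i b j : riemann h z (lf a) (rg i) (lf b) (rg j) =
  - (r y * (partial b (grad_up a) y + \sum_c christoffel g a b c y * grad_up c y)) *
    gam x j i.
Proof.
rewrite /riemann partial_lshift partial_rshift.
rewrite [X in X - _ + _](eq_partial_on _ openU Uy (g := fun y => gam x j i * - (r y *
  grad_up a y))); last first.
  move=> y' Uy' /=.
  by rewrite christoffelE // mulrC.
rewrite [X in _ - X + _](eq_partial_on _ openV Vx (g := fun=> 0)); last first.
  move=> x' Vx' /=.
  by rewrite christoffelE.
rewrite partial_cst subr0 (has_gradE _ (has_gradZ _ (has_gradN
  (has_gradM (has_grad_partial (r_diff Uy)) (has_grad_partial (grad_up_diff a Uy)))))).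
rewrite big_split_ord /=.
(* This sum cancels the term produced when the derivative falls on the factor [r] of
   [r * grad_up a]. *)
have -> : \sum_k (christoffel h (lf a) (lf b) (rg k) z *
    christoffel h (rg k) (rg j) (rg i) z -
    christoffel h (lf a) (rg j) (rg k) z * christoffel h (rg k) (lf b) (rg i) z) =
    grad_up a y * partial b r y * gam x j i.
  transitivity (\sum_k (k == i)%:R * (grad_up a y * partial b r y * gam x j k)).
    by apply: eq_bigr => k _; rewrite !christoffelE //; field; exact: r_neq0.
  by rewrite sum_delta.
have -> : \sum_c (christoffel h (lf a) (lf b) (lf c) z *
    christoffel h (lf c) (rg j) (rg i) z -
    christoffel h (lf a) (rg j) (lf c) z * christoffel h (lf c) (lf b) (rg i) z) =
    - (r y * gam x j i) * \sum_c christoffel g a b c y * grad_up c y.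
  rewrite mulr_sumr; apply: eq_bigr => c _; rewrite !christoffelE //; ring.
ring.
Qed.

(** Computed directly: deducing it from type LRLR would require the antisymmetry of the lowered
    tensor in its first pair, which is not visible in the definition. *)
Lemma riemann_warped_RLRL k a l c : riemann h z (rg k) (lf a) (rg l) (lf c) =
  - (k == l)%:R * hess c a y / r y.
Proof.
rewrite /riemann partial_lshift partial_rshift.
rewrite [X in X - _ + _](eq_partial_on _ openV Vx (g := fun=> 0)); last first.
  move=> x' Vx' /=.
  by rewrite christoffelE.
rewrite [X in _ - X + _](eq_partial_on _ openU Uy (g := fun y => (k == l)%:R * (partial
  a r y * (r y)^-1))); last first.
  move=> y' Uy' /=.
  by rewrite christoffelE // mulrC.
rewrite partial_cst sub0r (has_gradE _ (has_gradZ _ (has_gradM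
  (has_grad_partial (r_diff2 Uy a)) (has_gradV (r_neq0 Uy) (has_grad_partial (r_diff
    Uy)))))).
rewrite big_split_ord /=.
have -> : \sum_m (christoffel h (rg k) (rg l) (rg m) z *
    christoffel h (rg m) (lf c) (lf a) z -
    christoffel h (rg k) (lf c) (rg m) z * christoffel h (rg m) (rg l) (lf a) z) =
    - (partial c r y / r y * (partial a r y / r y) * (k == l)%:R).
  transitivity (\sum_m (m == l)%:R * (- (partial c r y / r y * (partial a r y / r y) *
    (k == m)%:R))).
    by apply: eq_bigr => m _; rewrite !christoffelE //; ring.
  by rewrite sum_delta.
have -> : \sum_b (christoffel h (rg k) (rg l) (lf b) z *
    christoffel h (lf b) (lf c) (lf a) z -
    christoffel h (rg k) (lf c) (lf b) z * christoffel h (lf b) (rg l) (lf a) z) =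
    (k == l)%:R / r y * \sum_b christoffel g b c a y * partial b r y.
  rewrite mulr_sumr; apply: eq_bigr => b _; rewrite !christoffelE //; ring.
rewrite /hess; field; exact: r_neq0.
Qed.

Lemma invg_sym a b : invmx (g y) a b = invmx (g y) b a.
Proof.
have gT : (g y)^T = g y by apply/matrixP => i j; rewrite mxE g_sym.
by rewrite -{1}gT -trmx_inv mxE.
Qed.

(* Metric compatibility: [D_b D^a r = g^{ac} D_b D_c r]. *)
Lemma cov_grad_up a b :
  partial b (grad_up a) y + \sum_c christoffel g a b c y * grad_up c y =
  \sum_c invmx (g y) a c * hess b c y.
Proof.
have dup c := has_grad_partial (grad_up_diff c Uy).
(* The lowered identity comes from differentiating [g_{cf} D^f r = D_c r]; in it the Christoffel
   symbols lose the inverse metric and the derivatives of [g] can be compared. The index is raised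
   again at the end. *)
have H c : \sum_f g y c f * (partial b (grad_up f) y +
    \sum_q christoffel g f b q y * grad_up q y) = hess b c y.
  have E1 : partial b (partial c r) y =
      \sum_f (g y c f * partial b (grad_up f) y +
              grad_up f y * partial b (fun y => g y c f) y).
    rewrite -(eq_partial_on b openU Uy (f := fun y => \sum_f g y c f * grad_up f y)).
      have HG : has_grad (fun y => \sum_f g y c f * grad_up f y) y (fun b => \sum_f
          (g y c f * partial b (grad_up f) y +
           grad_up f y * partial b (fun y => g y c f) y)).
        apply: has_grad_sum => f _.
        exact: has_gradM (has_grad_partial (g_diff Uy c f)) (dup f).
      by rewrite (has_gradE b HG).
    by move=> y' Uy'; exact: grad_lower.
  have low q : \sum_f g y c f * christoffel g f b q y =
      2^-1 * (partial b (fun y => g y c q) y + partial q (fun y => g y c b) y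
              - partial c (fun y => g y b q) y).
    rewrite /christoffel.
    under eq_bigr do rewrite mulrCA mulr_sumr.
    rewrite -mulr_sumr exchange_big /=; congr (_ * _).
    transitivity (\sum_s (s == c)%:R * (partial b (fun y => g y s q) y
       + partial q (fun y => g y s b) y - partial s (fun y => g y b q) y)).
      apply: eq_bigr => s _; rewrite eq_sym -(sum_mul_invmx c s (g_unit Uy)) mulr_suml.
      by apply: eq_bigr => f _; rewrite mulrA.
    by rewrite sum_delta.
  have low2 : \sum_f christoffel g f b c y * partial f r y =
      \sum_q grad_up q y * (2^-1 * (partial b (fun y => g y q c) y
         + partial c (fun y => g y q b) y - partial q (fun y => g y b c) y)).
    rewrite /christoffel.
    under eq_bigr do rewrite -mulrA mulr_suml mulr_sumr.
    rewrite exchange_big /=; apply: eq_bigr => q _.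
    rewrite /grad_up mulr_suml; apply: eq_bigr => f _.
    by rewrite invg_sym; ring.
  rewrite /hess E1 low2.
  under eq_bigr do rewrite mulrDr.
  rewrite !big_split /= -addrA; congr (_ + _).
  transitivity (\sum_q (\sum_f g y c f * christoffel g f b q y) * grad_up q y).
    under eq_bigr do rewrite mulr_sumr.
    rewrite exchange_big; apply: eq_bigr => q _; rewrite mulr_suml.
    by apply: eq_bigr => f _; rewrite mulrA.
  rewrite -sumrB; apply: eq_bigr => q _; rewrite low.
  have sw b1 q1 c1 : partial b1 (fun y => g y q1 c1) y = partial b1 (fun y => g y c1
    q1) y.
    by apply: eq_partial_on openU Uy _ => y' Uy'; exact: g_sym.
  by rewrite (sw b q c) (sw c q b) (sw q b c); field.
under [RHS]eq_bigr do rewrite -H mulr_sumr.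
rewrite exchange_big /=.
transitivity (\sum_f (f == a)%:R * (partial b (grad_up f) y +
    \sum_q christoffel g f b q y * grad_up q y)); first by rewrite sum_delta.
apply: eq_bigr => f _; rewrite eq_sym -(sum_invmx_mul a f (g_unit Uy)) mulr_suml.
by apply: eq_bigr => c _; rewrite mulrA.
Qed.

(* [(Dr)^2] *)
Definition radial_sq (y : 'rV[R]_d) : R := \sum_a grad_up a y * partial a r y.

(** Adding Christoffel terms that cancel makes both derivatives in the product rule covariant; by
    [cov_grad_up] each half is then [D^a r D_b D_a r]. *)
Lemma radial_sq_grad : has_grad radial_sq y
  (fun b => 2 * \sum_a grad_up a y * hess b a y).
Proof.
apply: (@has_grad_eq _ _ _ _ (fun b => \sum_a
  (grad_up a y * partial b (partial a r) y + partial a r y * partial b (grad_up a) y))).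
  apply: has_grad_sum => a _.
  exact: has_gradM (has_grad_partial (grad_up_diff a Uy)) (has_grad_partial (r_diff2 Uy
    a)).
move=> b; rewrite mulrDl mul1r.
have E : \sum_a partial a r y * (partial b (grad_up a) y +
    \sum_c christoffel g a b c y * grad_up c y) = \sum_a grad_up a y * hess b a y.
  under eq_bigr do rewrite cov_grad_up mulr_sumr.
  rewrite exchange_big; apply: eq_bigr => c _ /=; rewrite /grad_up mulr_suml.
  by apply: eq_bigr => a _; rewrite invg_sym; ring.
rewrite -{2}E.
have -> : \sum_a grad_up a y * hess b a y = \sum_a grad_up a y * partial b (partial a r) y
    - \sum_a partial a r y * \sum_c christoffel g a b c y * grad_up c y.
  rewrite /hess; under eq_bigr do rewrite mulrBr.
  rewrite sumrB; congr (_ - _).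
  under eq_bigr do rewrite mulr_sumr.
  rewrite exchange_big; apply: eq_bigr => a _ /=; rewrite mulr_sumr.
  by apply: eq_bigr => c _; ring.
under [X in _ = _ + X]eq_bigr do rewrite mulrDr.
by rewrite !big_split /=; ring.
Qed.

Lemma riemann_mixed_RRRR i j k l :
  riemann_mixed h z (rg i) (rg j) (rg k) (rg l) =
  (r y ^+ 2)^-1 * (riemann_mixed gam x i j k l - radial_sq y * pair_delta R i j k l).
Proof.
have gu := gam_unit Vx.
rewrite [LHS]/riemann_mixed sum_rshift => [|a]; last first.
  by do 2![rewrite big1 // => ? _]; rewrite warpedE !mul0r.
transitivity (\sum_f \sum_p \sum_q (r y ^+ 2)^-1 * (gam x i f * riemann gam x f j p q
    * invmx (gam x) p k * invmx (gam x) q l - radial_sq y *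
    ((p == f)%:R * (gam x i f * gam x q j * invmx (gam x) p k * invmx (gam x) q l)
    - (q == f)%:R * (gam x i f * gam x p j * invmx (gam x) p k * invmx (gam x) q l)))).
  apply: eq_bigr => f _; rewrite sum_rshift => [|a]; last first.
    by rewrite big1 // => ? _; rewrite [invmx _ (lf a) _]invwE // mulr0 mul0r.
  apply: eq_bigr => p _; rewrite sum_rshift => [|a]; last by rewrite !invwE // mulr0.
  apply: eq_bigr => q _.
  rewrite warpedE riemann_warped_RRRR !invwE // -/(radial_sq y) (eq_sym f p) (eq_sym f q).
  by field; exact: r_neq0.
under eq_bigr do under eq_bigr do rewrite -mulr_sumr.
under eq_bigr do rewrite -mulr_sumr.
rewrite -mulr_sumr; congr (_ * _).
under eq_bigr do under eq_bigr do rewrite sumrB -mulr_sumr.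
under eq_bigr do rewrite sumrB -mulr_sumr.
rewrite sumrB -mulr_sumr; congr (_ - _ * _).
rewrite pair_deltaE.
under eq_bigr do under eq_bigr do rewrite sumrB sum_delta -mulr_sumr.
under eq_bigr do rewrite sumrB sum_delta.
rewrite sumrB; congr (_ - _).
  rewrite (eq_sym k) (eq_sym l) -(sum_mul_invmx i k gu) -(sum_mul_invmx j l gu) mulr_suml.
  apply: eq_bigr => f _; rewrite mulr_sumr; apply: eq_bigr => q _.
  by rewrite (gam_sym Vx q j); ring.
rewrite (eq_sym k) (eq_sym l) mulrC -(sum_mul_invmx i l gu) -(sum_mul_invmx j k gu)
  mulr_suml.
apply: eq_bigr => f _; rewrite mulr_sumr; apply: eq_bigr => p _.
by rewrite (gam_sym Vx p j); ring.
Qed.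

(* The components [R_{ai}^{bi}], without sum over [i]. *)
Definition mixed_hess (a b : 'I_d) : R :=
  - ((\sum_p hess p a y * invmx (g y) p b) / r y).

Lemma riemann_mixed_RRLR i j a k :
  riemann_mixed h z (rg i) (rg j) (lf a) (rg k) = 0.
Proof.
rewrite [LHS]/riemann_mixed sum_rshift => [|b]; last first.
  by do 2![rewrite big1 // => ? _]; rewrite warpedE !mul0r.
rewrite big1 // => f _; rewrite sum_lshift => [|b]; last first.
  by rewrite big1 // => ? _; rewrite [invmx _ (rg b) _]invwE // mulr0 mul0r.
rewrite big1 // => p _; rewrite sum_rshift => [|b]; last by rewrite [invmx _ (lf b)
  _]invwE // mulr0.
by rewrite big1 // => q _; rewrite riemann_warped_RRLR mulr0 !mul0r.
Qed.

Lemma riemann_mixed_LRLR a i b j :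
  riemann_mixed h z (lf a) (rg i) (lf b) (rg j) = mixed_hess a b * (i == j)%:R.
Proof.
have gu := gam_unit Vx.
rewrite [LHS]/riemann_mixed sum_lshift => [|?]; last first.
  by do 2![rewrite big1 // => ? _]; rewrite warpedE !mul0r.
transitivity (\sum_c \sum_p \sum_q - (r y)^-1 * (g y a c * (\sum_s invmx (g y) c s *
  hess p s y)
   * invmx (g y) p b) * (gam x i q * invmx (gam x) q j)).
  apply: eq_bigr => c _; rewrite sum_lshift => [|?]; last first.
    by rewrite big1 // => ? _; rewrite [invmx _ (rg _) (lf b)]invwE // mulr0 mul0r.
  apply: eq_bigr => p _; rewrite sum_rshift => [|?]; last first.
    by rewrite [invmx _ (lf _) (rg j)]invwE // mulr0.
  apply: eq_bigr => q _.
  rewrite warpedE riemann_warped_LRLR !invwE // cov_grad_up (gam_sym Vx q).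
  by field; exact: r_neq0.
under eq_bigr do (under eq_bigr do rewrite -mulr_sumr sum_mul_invmx //).
rewrite exchange_big /= /mixed_hess mulr_suml -sumrN mulr_suml.
apply: eq_bigr => p _.
have -> : hess p a y = \sum_c g y a c * (\sum_s invmx (g y) c s * hess p s y).
  under eq_bigr do rewrite mulr_sumr.
  rewrite exchange_big /=.
  transitivity (\sum_s (s == a)%:R * hess p s y); first by rewrite sum_delta.
  apply: eq_bigr => s _; rewrite eq_sym -(sum_mul_invmx a s (g_unit Uy)) mulr_suml.
  by apply: eq_bigr => c _; rewrite mulrA.
rewrite !mulr_suml -sumrN mulr_suml; apply: eq_bigr => c _.
by field; exact: r_neq0.
Qed.

Lemma riemann_mixed_RLRL i a j b :
  riemann_mixed h z (rg i) (lf a) (rg j) (lf b) = mixed_hess a b * (i == j)%:R.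
Proof.
have gu := gam_unit Vx.
rewrite [LHS]/riemann_mixed sum_rshift => [|?]; last first.
  by do 2![rewrite big1 // => ? _]; rewrite warpedE !mul0r.
transitivity (\sum_k \sum_l \sum_c (l == k)%:R * (- (r y)^-1 *
  (gam x i k * invmx (gam x) l j) * (hess c a y * invmx (g y) c b))).
  apply: eq_bigr => k _; rewrite sum_rshift => [|?]; last first.
    by rewrite big1 // => ? _; rewrite [invmx _ (lf _) (rg j)]invwE // mulr0 mul0r.
  apply: eq_bigr => l _; rewrite sum_lshift => [|?]; last first.
    by rewrite [invmx _ (rg _) (lf b)]invwE // mulr0.
  apply: eq_bigr => c _.
  rewrite warpedE riemann_warped_RLRL !invwE // (eq_sym k).
  by field; exact: r_neq0.
under eq_bigr do (under eq_bigr do rewrite -mulr_sumr; rewrite sum_delta -mulr_sumr).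
rewrite -mulr_suml -mulr_sumr sum_mul_invmx // /mixed_hess.
by field; exact: r_neq0.
Qed.

End Riemann.
End WarpedCurvature.

(** * The quasilocal mass *)

Section MassGradient.
Variables (R : realType) (n : nat) (w : nat -> R).

(* [F_m] *)
Definition lovelock_poly (m : nat) (X : R) : R :=
  \sum_(l < m.+1) 'C(m, l)%:R * (2 * X) ^+ l *
    (\prod_(p < 2 * l) (n%:R - 2 * m%:R + 1 + p%:R)) * w (m - l).

(** The coefficient of [r^(n-2m+1) (kappa - (Dr)^2)^(l+1)] in the double sum of [mass_formula]. *)
Definition mass_coef (a : nat -> R) (m l : nat) : R :=
  a m * (2 ^+ l / 2 ^+ m) / l.+1%:R * 'C(m.-1, l)%:R
  * (\prod_(0 <= p < (2 * l).+1) (n%:R - 2 * m%:R + 2 + p%:R)) * w (m.-1 - l)%N.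

(** The factor [p = 0] of the product is [n-2m+2]; the other [2l] factors are those of [F_{m-1}].
    The left side is the derivative in [X] of the polynomial in the mass. *)
Lemma sum_mass_coef_deriv (a : nat -> R) m X : (0 < m)%N ->
  \sum_(0 <= l < m) mass_coef a m l * (l.+1%:R * X ^+ l) =
  a m / (2 ^+ m.+1 * m%:R) * (2 * m%:R) * (n%:R - 2 * m%:R + 2) * lovelock_poly m.-1 X.
Proof.
case: m => // m _; rewrite /lovelock_poly big_mkord mulr_sumr.
apply: eq_bigr => l _; rewrite /mass_coef /=.
have -> : \prod_(0 <= p < (2 * l).+1) (n%:R - 2 * m.+1%:R + 2 + p%:R) =
    (n%:R - 2 * m.+1%:R + 2) * \prod_(p < 2 * l) (n%:R - 2 * m%:R + 1 + p%:R) :> R.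
  rewrite big_mkord big_ord_recl addr0; congr (_ * _); apply: eq_bigr => p _.
  by rewrite /= /bump /= add1n -[m.+1%:R]natr1 -[p.+1%:R]natr1; ring.
rewrite exprMn !exprS; field.
by rewrite !nat1r !pnatr_eq0 expf_neq0 ?pnatr_eq0.
Qed.

(** The prefactor [n-2m+1], which arises when the power of [r] is differentiated, is the first
    factor of the product in [F_m]; the binomials agree by [C(m,l+1) = m C(m-1,l) / (l+1)]. *)
Lemma sum_mass_coef (a : nat -> R) m X : (0 < m)%N ->
  a m / (2 ^+ m.+1 * m%:R) * w m +
  (n%:R - 2 * m%:R + 1) * \sum_(0 <= l < m) mass_coef a m l * X ^+ l.+1 =
  a m / (2 ^+ m.+1 * m%:R) * lovelock_poly m X.
Proof.
case: m => // m _; rewrite /lovelock_poly big_ord_recl mulrDr; congr (_ + _).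
  by rewrite bin0 big_ord0 expr0 subn0 !mul1r.
rewrite big_mkord !mulr_sumr; apply: eq_bigr => l _; rewrite /mass_coef /= /bump /= add1n.
have -> : \prod_(p < 2 * l.+1) (n%:R - 2 * m.+1%:R + 1 + p%:R) =
   (n%:R - 2 * m.+1%:R + 1) * \prod_(0 <= p < (2 * l).+1) (n%:R - 2 * m.+1%:R + 2 +
     p%:R) :> R.
  rewrite mulnS big_mkord [LHS]big_ord_recl addr0; congr (_ * _); apply: eq_bigr => p _.
  by rewrite /= /bump /= add1n -[p.+1%:R]natr1; ring.
have binE : 'C(m.+1, l.+1)%:R = m.+1%:R * 'C(m, l)%:R / l.+1%:R :> R.
  by rewrite -natrM mul_bin_diag natrM mulrAC divff ?mul1r ?pnatr_eq0.
rewrite binE subSS exprMn !exprS; field.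
by rewrite !nat1r !pnatr_eq0 expf_neq0 ?pnatr_eq0.
Qed.

Lemma expr_sub_2m (u : R) m k : u != 0 -> (2 * m <= k)%N ->
  u ^+ (k - 2 * m) = u ^+ k * (u ^+ 2)^-1 ^+ m.
Proof.
by move=> u0 mk; rewrite exprVn -exprM expfB_cond // (negPf u0) /=.
Qed.

Hypothesis w0 : forall m, (n < 2 * m)%N -> w m = 0.

(** The term [l = 0] contains [W(m) = 0], and every other one contains the factor [n-2m+1 = 0]. *)
Lemma lovelock_poly0 m X : (2 * m)%N = n.+1 -> lovelock_poly m X = 0.
Proof.
move=> e; rewrite /lovelock_poly big_ord_recl subn0 w0 ?e // mulr0 add0r.
apply: big1 => l _; rewrite /= /bump /= add1n mulnS big_ord_recl.
have -> : n%:R - 2 * m%:R + 1 + 0%:R = 0 :> R.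
  by rewrite -natrM e -natr1; ring.
by rewrite mul0r mulr0 mul0r.
Qed.

(** Differentiating the powers of [u] gives [F_m] by [sum_mass_coef]; differentiating those of
    [kappa - v] gives [F_{m-1}] by [sum_mass_coef_deriv]. *)
Lemma has_grad_mass d (a : nat -> R) (Lam kappa vol : R) (u v : 'rV[R]_d -> R) y G H :
  u y != 0 -> has_grad u y G -> has_grad v y H ->
  has_grad (fun y => mass_formula n a Lam kappa vol w (u y) (v y)) y
   (fun b => vol * u y ^+ n *
    ((\sum_(1 <= m < n.+1./2.+1) a m / (2 ^+ m.+1 * m%:R) * (u y ^+ 2)^-1 ^+ m
        * lovelock_poly m (kappa - v y) - Lam) * G b
     - (\sum_(1 <= m < n.+1./2.+1) a m / (2 ^+ m.+1 * m%:R) * (2 * m%:R)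
        * (n%:R - 2 * m%:R + 2) * u y * (u y ^+ 2)^-1 ^+ m
        * lovelock_poly m.-1 (kappa - v y)) * H b)).
Proof.
move=> u0 hu hv.
have hX : has_grad (fun y => kappa - v y) y (fun b => - H b).
  apply: has_grad_eq (has_gradD (has_grad_cst kappa y) (has_gradN hv)) _ => b.
  by rewrite add0r.
pose A m := a m / (2 ^+ m.+1 * m%:R).
pose N m := (n.+1 - 2 * m)%N.
have h1 : has_grad (fun y => \sum_(1 <= m < n.+1./2.+1 | (2 * m != n.+1)%N)
    (A m / (N m)%:R * w m) * u y ^+ N m) y
    (fun b => \sum_(1 <= m < n.+1./2.+1 | (2 * m != n.+1)%N)
    (A m / (N m)%:R * w m) * ((N m)%:R * u y ^+ (N m).-1 * G b)).
  by apply: has_grad_sum => m _; exact: has_gradZ (has_gradX _ hu).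
have h2 : has_grad (fun y => - (Lam / n.+1%:R) * u y ^+ n.+1) y
    (fun b => - (Lam / n.+1%:R) * (n.+1%:R * u y ^+ n * G b)).
  exact: has_gradZ (has_gradX _ hu).
have h3 : has_grad (fun y => \sum_(1 <= m < n.+1./2.+1) \sum_(0 <= l < m)
    mass_coef a m l * (u y ^+ N m * (kappa - v y) ^+ l.+1)) y
    (fun b => \sum_(1 <= m < n.+1./2.+1) \sum_(0 <= l < m)
    mass_coef a m l * (u y ^+ N m * (l.+1%:R * (kappa - v y) ^+ l * - H b) +
       (kappa - v y) ^+ l.+1 * ((N m)%:R * u y ^+ (N m).-1 * G b))).
  apply: has_grad_sum => m _; apply: has_grad_sum => l _.
  exact: has_gradZ (has_gradM (has_gradX _ hu) (has_gradX _ hX)).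
have := has_gradZ vol (has_gradD (has_gradD h1 h2) h3).
set F := (X in has_grad X) => hF.
have -> : (fun y => mass_formula n a Lam kappa vol w (u y) (v y)) = F.
  apply: funext => y'; rewrite /F /mass_formula; congr (_ * (_ + _ + _)).
  - by apply: eq_bigr => m _; rewrite /A /N; ring.
  - by field; rewrite nat1r pnatr_eq0.
  - apply: eq_bigr => m _; apply: eq_bigr => l _; rewrite /mass_coef /N; ring.
apply: has_grad_eq hF _ => b; rewrite -[RHS]mulrA; congr (vol * _).
set X := kappa - v y; set U := u y.
pose T m := A m * (U ^+ 2)^-1 ^+ m * lovelock_poly m X.
pose T' m := A m * (2 * m%:R) * (n%:R - 2 * m%:R + 2) * U * (U ^+ 2)^-1 ^+ m
  * lovelock_poly m.-1 X.
have E m : (1 <= m < n.+1./2.+1)%N ->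
    (if (2 * m != n.+1)%N then A m / (N m)%:R * w m * ((N m)%:R * U ^+ (N m).-1 * G b)
     else 0) + \sum_(0 <= l < m) mass_coef a m l *
      (U ^+ N m * (l.+1%:R * X ^+ l * - H b) + X ^+ l.+1 * ((N m)%:R * U ^+ (N m).-1 *
        G b))
    = U ^+ n * (T m * G b - T' m * H b).
  move=> /andP[m0 mk].
  have mn : (2 * m <= n.+1)%N.
    by rewrite mul2n -geq_half_double.
  have -> : \sum_(0 <= l < m) mass_coef a m l *
      (U ^+ N m * (l.+1%:R * X ^+ l * - H b) + X ^+ l.+1 * ((N m)%:R * U ^+ (N m).-1 *
        G b))
    = - (U ^+ N m * H b) * (\sum_(0 <= l < m) mass_coef a m l * (l.+1%:R * X ^+ l))
     + (N m)%:R * U ^+ (N m).-1 * G b * (\sum_(0 <= l < m) mass_coef a m l * X ^+ l.+1).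
    rewrite !mulr_sumr -big_split; apply: eq_bigr => l _ /=; ring.
  have UN : U ^+ N m = U * U ^+ n * (U ^+ 2)^-1 ^+ m by rewrite expr_sub_2m // exprS.
  rewrite sum_mass_coef_deriv // -/(A m) /T' UN.
  (* In the exceptional case the power of [u] is constant and the first sum has no term, in
     agreement with [F_m = 0]; only the part with [H b] remains. *)
  have [e|ne] := eqVneq (2 * m)%N n.+1.
    have -> : N m = 0%N by rewrite /N e subnn.
    rewrite /T (lovelock_poly0 X e) /=.
    by ring.
  have lt : (2 * m <= n)%N by rewrite -ltnS ltn_neqAle ne.
  have N0 : (N m)%:R != 0 :> R by rewrite pnatr_eq0 /N subn_eq0 -ltnNge.
  have NE : (N m)%:R = n%:R - 2 * m%:R + 1 :> R.
    by rewrite /N natrB // natrM -natr1; ring.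
  have UE : U ^+ (N m).-1 = U ^+ n * (U ^+ 2)^-1 ^+ m.
    by rewrite /N subSn //= expr_sub_2m.
  have TE : T m = (U ^+ 2)^-1 ^+ m * (A m * w m + (N m)%:R *
      \sum_(0 <= l < m) mass_coef a m l * X ^+ l.+1).
    by rewrite NE /A sum_mass_coef // /T /A mulrCA mulrA.
  rewrite /= UE TE.
  by move: (N m)%:R N0 (\sum_(0 <= l < m) _) => q q0 S; field.
rewrite big_mkcond /= -/U -/X.
transitivity (\sum_(1 <= m < n.+1./2.+1) U ^+ n * (T m * G b - T' m * H b) - Lam * U ^+
  n * G b).
  rewrite -(eq_big_nat _ _ E) big_split /= addrAC; congr (_ + _).
  by field; rewrite nat1r pnatr_eq0.
by rewrite -mulr_sumr sumrB -!mulr_suml -/T -/T'; ring.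
Qed.
End MassGradient.

(** * Field equations of the warped product and the first law *)

Lemma contr_sdelta_gt (R : realType) d m (Q : 'I_d -> 'I_d -> 'I_d -> 'I_d -> R) :
  (d < 2 * m)%N -> contr m (@sdelta R _) Q = 0.
Proof.
rewrite mul2n => dm; apply: contr_eq0 => rho sigma s1 s2.
apply/eqP; apply: contraT => /sdelta_neq0; rewrite s1 s2 => /(_ erefl) /andP[u _].
by have := max_card (mem rho); rewrite card_ord (card_uniqP u) s1 leqNgt dm.
Qed.

Lemma posdef_unitmx (R : realType) d (A : 'M[R]_d) :
  (forall v : 'rV[R]_d, v != 0 -> 0 < (v *m A *m v^T) 0 0) -> A \in unitmx.
Proof.
move=> H; rewrite -row_free_unit -kermx_eq0; apply: contraT => k0.
have := H _ (_ : nz_row (kermx A) != 0); rewrite nz_row_eq0 => /(_ k0).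
have /sub_kermxP -> : (nz_row (kermx A) <= kermx A)%MS by exact: nz_row_sub.
by rewrite mul0mx mxE ltxx.
Qed.

Lemma lorentz_unitmx (R : realType) d (A E : 'M[R]_d) :
  E *m A *m E^T = diag_mx (\row_a (if (a : nat) == 0%N then -1 else 1)) ->
  A \in unitmx.
Proof.
move=> H; rewrite unitmxE unitfE; apply/eqP => A0.
have := congr1 determinant H; rewrite !det_mulmx A0 mulr0 mul0r det_diag.
move=> /esym /eqP; rewrite prodf_seq_eq0 => /hasP[i _] /=; rewrite !mxE.
by case: ifP => _; rewrite ?oppr_eq0 oner_eq0.
Qed.

Lemma sdelta2 (R : realType) (T : eqType) (a b c d : T) :
  sdelta R [:: a; c] [:: b; d] =
  (a == b)%:R * (c == d)%:R - (a == d)%:R * (c == b)%:R.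
Proof.
rewrite /sdelta (expand_det_row _ 0) !big_ord_recl big_ord0.
rewrite /cofactor !det_mx11 !mxE /= /bump /= addr0 !(inj_eq Some_inj).
by rewrite expr0 expr1 mul1r mulN1r mulrN.
Qed.

Section FirstLaw.
Variables (R : realType) (n : nat).
Variables (U : set 'rV[R]_2) (V : set 'rV[R]_n).
Hypotheses (openU : open U) (openV : open V).
Variables (g : 'rV[R]_2 -> 'M[R]_2) (r : 'rV[R]_2 -> R) (gam : 'rV[R]_n -> 'M[R]_n).
Hypothesis g_diff : forall y, U y -> forall a b, differentiable (fun y => g y a b) y.
Hypothesis g_sym : forall y, U y -> forall a b, g y a b = g y b a.
Hypothesis g_unit : forall y, U y -> g y \in unitmx.
Hypothesis gam_diff : forall x, V x -> forall i j, differentiable (fun x => gam x i j) x.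
Hypothesis gam_sym : forall x, V x -> forall i j, gam x i j = gam x j i.
Hypothesis gam_unit : forall x, V x -> gam x \in unitmx.
Hypothesis r_diff : forall y, U y -> differentiable r y.
Hypothesis r_diff2 : forall y, U y -> forall a, differentiable (partial a r) y.
Hypothesis r_neq0 : forall y, U y -> r y != 0.
Variables (y : 'rV[R]_2) (x : 'rV[R]_n).
Hypotheses (Uy : U y) (Vx : V x).
Variables (kappa : R) (w : nat -> R).
Hypothesis hW : forall m, delta_contract m (weyl kappa gam x) = w m.
Variables (a : nat -> R) (Lam : R).

Local Notation lf := (@lshift 2 n).
Local Notation rg := (@rshift 2 n).
Local Notation z := (row_mx y x).
Local Notation h := (warped g r gam).
Local Notation mh := (mixed_hess g r y).
Local Notation X := (kappa - radial_sq g r y).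
Local Notation Fm := (lovelock_poly n w).

Lemma delta_contract1_warped m c b :
  delta_contract1 m (riemann_mixed h z) (lf c) (lf b) =
  (c == b)%:R * ((r y ^+ 2)^-1 ^+ m * Fm m X) +
  4 * m%:R * ((c == b)%:R * (\sum_d mh d d) - mh b c) * (n%:R - 2 * (m%:R - 1)) *
    ((r y ^+ 2)^-1 ^+ m.-1 * Fm m.-1 X).
Proof.
pose QK i j k l := riemann_mixed h z (rg i) (rg j) (rg k) (rg l).
have QKE q : contr q (@sdelta R _) QK = (r y ^+ 2)^-1 ^+ q * Fm q X.
  rewrite -[Fm q X](_ : contr q (@sdelta R _) (fun i j k l =>
      weyl kappa gam x i j k l + X * pair_delta R i j k l) = _).
    rewrite -contr_scaleQ; apply: eq_contrQ => i j k l.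
    rewrite /QK; have -> := @riemann_mixed_RRRR _ _ _ U V; rewrite //.
    congr (_ * _); by rewrite /weyl -/(pair_delta R i j k l); ring.
  rewrite (contr_shift _ _ _ (mu := [::]) (nu := [::])) // /lovelock_poly.
  apply: eq_bigr => l _; congr (_ * _ * _).
    by apply: eq_bigr => p _; rewrite /= natrM subr0.
  by rewrite -delta_contractE hW.
rewrite delta_contract1E.
have mLR i0 c0 d0 j0 : riemann_mixed h z (lf c0) (rg i0) (lf d0) (rg j0) = mh c0 d0 *
  (i0 == j0)%:R.
  by apply: (@riemann_mixed_LRLR _ _ _ U V).
have mRL i0 c0 d0 j0 : riemann_mixed h z (rg i0) (lf c0) (rg j0) (lf d0) = mh c0 d0 *
  (i0 == j0)%:R.
  by apply: (@riemann_mixed_RLRL _ _ _ U V).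
have mRR i0 j0 k0 c0 : riemann_mixed h z (rg i0) (rg j0) (lf c0) (rg k0) = 0.
  by apply: (@riemann_mixed_RRLR _ _ _ U V).
have key := @contr_product R n (riemann_mixed h z) _ _ mh _ _ _ _ m c b [::] [::] erefl.
rewrite /= in key; rewrite key.
- rewrite -/QK !QKE subr0; congr (_ + 4 * _ * _ * _ * _).
  (* The delta with two pairs turns the mixed components into their trace minus their transpose. *)
  under eq_bigr do under eq_bigr do rewrite sdelta2 mulrBl.
  under eq_bigr do rewrite sumrB.
  rewrite sumrB; congr (_ - _).
    rewrite mulr_sumr; apply: eq_bigr => i _.
    by under eq_bigr do rewrite -mulrA mulrCA eq_sym; rewrite sum_delta.
  rewrite exchange_big /=.
  under eq_bigr do (under eq_bigr do rewrite -mulrA mulrCA; rewrite sum_delta eq_sym).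
  by rewrite sum_delta.
- by move=> i j k l; rewrite riemann_mixedC mRR oppr0.
- by move=> i j k l; rewrite mRR.
- by move=> *; rewrite mLR.
- by move=> *; rewrite mRL.
- by move=> *; rewrite riemann_mixedC mLR.
- by move=> *; rewrite riemann_mixedC mRL.
Qed.

Let cm m : R := a m / (2 ^+ m.+1 * m%:R).
Let alpha : R := Lam - \sum_(1 <= m < n.+1./2.+1) cm m * (r y ^+ 2)^-1 ^+ m * Fm m X.
Let beta : R := - \sum_(1 <= m < n.+1./2.+1)
  cm m * (4 * m%:R) * (n%:R - 2 * m%:R + 2) * (r y ^+ 2)^-1 ^+ m.-1 * Fm m.-1 X.

(** [alpha] collects [Lam] and the terms without a mixed factor, [beta] the coefficients of those
    with one. *)
Lemma lovelock_warped c b : lovelock a Lam h z (lf c) (lf b) =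
  (c == b)%:R * alpha + beta * ((c == b)%:R * (\sum_d mh d d) - mh b c).
Proof.
rewrite /lovelock mxE (inj_eq (@lshift_inj _ _)) /alpha /beta.
set S := _ - mh b c; rewrite mulrBr mulNr mulr_suml.
rewrite [Lam * _]mulrC addrC -addrA; congr (_ + _).
rewrite -opprD; congr (- _); rewrite mulr_sumr -big_split.
apply: eq_big_nat => m /andP[m0 _] /=.
have -> : (2 ^+ m.+1)^-1 * (a m / m%:R) = cm m by rewrite /cm invfM; ring.
by rewrite delta_contract1_warped -/S; move: (cm m) => q; ring.
Qed.

Lemma lower_mixed_hess b c : \sum_d g y b d * mh c d = - (hess g r b c y / r y).
Proof.
rewrite /mixed_hess; under eq_bigr do rewrite mulrN mulrA.
rewrite sumrN -mulr_suml; congr (- (_ / _)).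
transitivity (\sum_p (p == b)%:R * hess g r p c y); last by rewrite sum_delta.
under eq_bigr do rewrite mulr_sumr.
rewrite exchange_big; apply: eq_bigr => p _ /=.
have := mulmxV (g_unit Uy); move/matrixP/(_ b p); rewrite !mxE eq_sym => <-.
rewrite mulr_suml; apply: eq_bigr => d _.
by rewrite (invg_sym g_sym Uy p d); ring.
Qed.

Variable t : 'M[R]_2.
Hypothesis field_eq : forall b c,
  (h z *m lovelock a Lam h z) (lf b) (lf c) = t b c.

Let tau := \sum_d mh d d.

Lemma stress_warped b c :
  t b c = (alpha + beta * tau) * g y b c + beta * hess g r b c y / r y.
Proof.
rewrite -field_eq mxE big_split_ord /= [X in _ + X]big1 ?addr0 => [|i _]; last first.
  by rewrite warpedE mul0r.
transitivity (\sum_d ((d == c)%:R * ((alpha + beta * tau) * g y b d) - beta * (g y b d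
  * mh c d))).
  by apply: eq_bigr => d _; rewrite warpedE lovelock_warped -/tau; ring.
by rewrite sumrB sum_delta -mulr_sumr lower_mixed_hess; ring.
Qed.

(** The metric has trace 2, and the trace of the Hessian is [- r * tau], which removes one of the
    two copies of [beta * tau]. *)
Lemma trace_stress : \tr (invmx (g y) *m t) = 2 * alpha + beta * tau.
Proof.
rewrite /mxtrace.
transitivity (\sum_(b < 2) ((alpha + beta * tau) - beta * mh b b)).
  apply: eq_bigr => b _; rewrite mxE.
  under eq_bigr do rewrite stress_warped mulrDr mulrCA.
  rewrite big_split /= -mulr_sumr.
  have := mulVmx (g_unit Uy); move/matrixP/(_ b b); rewrite !mxE eqxx mulr1n => ->.
  rewrite mulr1; congr (_ + _); rewrite /mixed_hess mulrN opprK mulr_suml mulr_sumr.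
  by apply: eq_bigr => c _; rewrite (invg_sym g_sym Uy b c); ring.
rewrite sumrB -mulr_sumr -/tau sumr_const card_ord -mulr_natl; ring.
Qed.

(** The left side has the form of the gradient in [has_grad_mass]. On the right the total
    coefficient of [D_b r] is [alpha + beta * tau + 2 P]; by [trace_stress] it equals [- alpha], so
    the trace of the Hessian drops out. *)
Lemma first_law_identity vol b (P := - (2^-1 * \tr (invmx (g y) *m t))) :
  vol * r y ^+ n *
    ((\sum_(1 <= m < n.+1./2.+1) a m / (2 ^+ m.+1 * m%:R) * (r y ^+ 2)^-1 ^+ m
        * Fm m X - Lam) * partial b r y
     - (\sum_(1 <= m < n.+1./2.+1) a m / (2 ^+ m.+1 * m%:R) * (2 * m%:R)
        * (n%:R - 2 * m%:R + 2) * r y * (r y ^+ 2)^-1 ^+ m * Fm m.-1 X) *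
       (2 * \sum_c grad_up g r c y * hess g r b c y)) =
  vol * r y ^+ n * (\sum_c (t b c + P * g y b c) * grad_up g r c y)
  + P * (vol * r y ^+ n * partial b r y).
Proof.
have -> : \sum_(1 <= m < n.+1./2.+1) a m / (2 ^+ m.+1 * m%:R) * (r y ^+ 2)^-1 ^+ m
        * Fm m X - Lam = - alpha by rewrite /alpha opprB.
(* [beta] carries [4m] where the mass carries [2m], and [r * r^(-2m) = r^(-2(m-1)) / r]. *)
have -> : \sum_(1 <= m < n.+1./2.+1) a m / (2 ^+ m.+1 * m%:R) * (2 * m%:R)
        * (n%:R - 2 * m%:R + 2) * r y * (r y ^+ 2)^-1 ^+ m * Fm m.-1 X =
    - (2^-1 * beta / r y).
  rewrite /beta mulrN mulNr opprK mulr_sumr mulr_suml; apply: eq_big_nat => m /andP[m0 _].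
  rewrite -/(cm m) -[in LHS](prednK m0) exprS prednK //.
  by move: (_ ^+ m.-1) => q; field; rewrite r_neq0.
have -> : \sum_c (t b c + P * g y b c) * grad_up g r c y =
    (alpha + beta * tau + P) * partial b r y +
    beta / r y * \sum_c grad_up g r c y * hess g r b c y.
  rewrite -(grad_lower r g_unit b Uy) [X in _ = X + _]mulr_sumr.
  rewrite [X in _ = _ + X]mulr_sumr -big_split.
  by apply: eq_bigr => c _; rewrite stress_warped /=; ring.
rewrite /P trace_stress.
by move: (\sum_c _) => S; field; rewrite r_neq0.
Qed.

End FirstLaw.

Theorem mainTheorem2
  (R : realType) (n : nat) (hn : (4 <= n)%N)
  (a : nat -> R) (ha1 : a 1%N = 1) (Lam : R)
  (M : topologicalType) (AM : atlas R 2 M) (hM : smooth_manifold AM)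
  (g : field2 AM) (hg : lorentzian_metric g)
  (X : chart_index AM -> 'rV[R]_2 -> 'rV[R]_2) (hX : time_orientation g X)
  (r : M -> R) (hr : smooth_fun AM r) (hr0 : forall q : M, 0 < r q)
  (K : ptopologicalType) (AK : atlas R n K) (hK : smooth_manifold AK)
  (hKc : compact [set: K])
  (gam : field2 AK) (hgam : riemannian_metric gam)
  (kappa : R) (hkappa : kappa \in [:: -1; 0; 1])
  (hE : einstein gam ((n%:R - 1) * kappa))
  (mu : {measure set (borel_of K) -> \bar R}) (hmu : riemannian_volume gam mu)
  (w : nat -> R)
  (hW : forall (m : nat) (j : chart_index AK) (x : 'rV[R]_n), chart_img j x ->
     delta_contract m (weyl kappa (gam j) x) = w m)
  (hWij : forall (m : nat) (j : chart_index AK) (x : 'rV[R]_n), chart_img j x ->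
     forall k l : 'I_n,
       delta_contract1 m (weyl kappa (gam j) x) k l =
       (n%:R - 2 * m%:R) / n%:R * (k == l)%:R
       * delta_contract m (weyl kappa (gam j) x))
  (t : field2 AM) (ht : sym_tensor2 t) (p : M -> R)
  (hfield : lovelock_equations a Lam
     (warped_tensor g (fun q => r q ^+ 2) gam)
     (warped_tensor t (fun q => r q ^+ 2 * p q) gam)) :
  let vol := fine (mu setT) in
  forall (i : chart_index AM) (y : 'rV[R]_2), chart_img i y ->
    differentiable (quasilocal_mass n g r vol i a Lam kappa w) y /\
    grad (quasilocal_mass n g r vol i a Lam kappa w) y =
      area n r vol i y *: energy_flux_low g t r i y
      + work_density g t i y *: grad (areal_volume n r vol i) y.
Proof.
move=> vol i y iy.
have [q iq qy] := iy.
have [_ _ chM _ _] := hM; have [_ _ chK covK _] := hK.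
(* Both sides of the law depend on [y] only, so the field equations are evaluated over a single
   fibre point; [K] is pointed and provides one. *)
have [j jk] := covK point.
pose x := chart_map j point.
have jx : chart_img j x by exists point.
have openU : open (chart_img i) by have [] := chM i.
have openV : open (chart_img j) by have [] := chK j.
have [g_smooth [g_symT _] g_sig] := hg.
have [gam_smooth [gam_symT _] gam_pos] := hgam.
have g_diff y' : chart_img i y' -> forall b c, differentiable (fun v => g i v b c) y'.
  by move=> iy' b c; exact: (g_smooth i b c [::] y' iy').
have g_sym y' : chart_img i y' -> forall b c, g i y' b c = g i y' c b.
  by move=> iy' b c; rewrite -[in LHS](g_symT i y' iy') mxE.
have g_unit y' : chart_img i y' -> g i y' \in unitmx.
  by move=> iy'; have [E _ /lorentz_unitmx] := g_sig i y' iy'.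
have gam_diff x' : chart_img j x' -> forall b c, differentiable (fun v => gam j v b c) x'.
  by move=> jx' b c; exact: (gam_smooth j b c [::] x' jx').
have gam_sym x' : chart_img j x' -> forall b c, gam j x' b c = gam j x' c b.
  by move=> jx' b c; rewrite -[in LHS](gam_symT j x' jx') mxE.
have gam_unit x' : chart_img j x' -> gam j x' \in unitmx.
  by move=> jx'; apply: posdef_unitmx; exact: gam_pos.
pose rr := local_radius r i.
have r_diff y' : chart_img i y' -> differentiable rr y'.
  by move=> iy'; exact: (hr i [::] y' iy').
have r_diff2 y' : chart_img i y' -> forall b, differentiable (partial b rr) y'.
  by move=> iy' b; exact: (hr i [:: b] y' iy').
have r_neq0 y' : chart_img i y' -> rr y' != 0.
  by move=> _; rewrite gt_eqF // hr0.
have w0 m : (n < 2 * m)%N -> w m = 0.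
  by move=> nm; rewrite -(hW m j x jx) delta_contractE contr_sdelta_gt.
have hz : chart_img (A := prod_atlas AM AK) (i, j) (row_mx y x).
  by exists (q, point) => //=; rewrite qy.
have field_eq b c : (warped (g i) rr (gam j) (row_mx y x) *m
    lovelock a Lam (warped (g i) rr (gam j)) (row_mx y x)) (lshift n b) (lshift n c) =
      t i y b c.
  have := hfield (i, j) (row_mx y x) hz.
  move/matrixP/(_ (lshift n b) (lshift n c)) => E.
  by rewrite [LHS]E /warped_tensor block_mxEul row_mxKl.
have Dr2E y' : grad_sq g r i y' = radial_sq (g i) rr y'.
  rewrite /grad_sq /radial_sq mxE.
  under eq_bigr do rewrite mxE mulr_suml.
  rewrite exchange_big; apply: eq_bigr => b _; rewrite /grad_up mulr_suml.
  by apply: eq_bigr => c _; rewrite !mxE; ring.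
have massE : quasilocal_mass n g r vol i a Lam kappa w =
    fun v => mass_formula n a Lam kappa vol w (rr v) (radial_sq (g i) rr v).
  by apply: funext => v; rewrite /quasilocal_mass Dr2E.
have hrr := has_grad_partial (r_diff y iy).
have hrs : has_grad (radial_sq (g i) rr) y
    (fun b => 2 * \sum_c grad_up (g i) rr c y * hess (g i) rr b c y).
  exact: (radial_sq_grad openU).
have [dM gM] := has_grad_mass (w := w) w0 a Lam kappa vol (r_neq0 y iy) hrr hrs.
rewrite massE; split => //.
apply/rowP => b; rewrite !mxE gM.
have hW' m : delta_contract m (weyl kappa (gam j) x) = w m by exact: hW.
rewrite (@first_law_identity R n (chart_img i) (chart_img j) openU openV (g i) rr (gam j)
  g_diff g_sym g_unit gam_diff gam_sym gam_unit r_diff r_diff2 r_neq0 y x iy jx kappa w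
    hW'
  a Lam (t i y) field_eq vol b).
congr (_ * _ + _ * _).
  (* Lowering the index of [psi] cancels the inverse metric in front and leaves
     [\hat T_{bc} D^c r]. *)
  transitivity ((g i y *m energy_flux g t r i y) b 0); last by rewrite mxE.
  rewrite /energy_flux !mulmxA mulmxV ?g_unit // mul1mx -mulmxA mxE.
  apply: eq_bigr => c _; rewrite !mxE; congr (_ * _).
  by apply: eq_bigr => e _; rewrite !mxE.
(* This is [dV = A dr]. *)
rewrite (has_gradE b (has_gradZ (vol / n.+1%:R) (has_gradX n.+1 hrr))) /=.
by field; rewrite nat1r pnatr_eq0.
Qed.
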